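(* Suppose $\nabla\widehat f$ is approximated from samples of $f$, with $\widetilde{\operatorname{grad}}f(r):=\mathrm Dg^\star(0\,|\,r)\,G_r^{-1}\,\nabla p^f_r(0)$, $G_r:=\mathrm Dg^\star(0\,|\,r)^T\mathrm Dg^\star(0\,|\,r)$. Suppose $f$ is gradient $L$-Lipschitz on $\operatorname{Conv}(\widetilde{\mathcal M}\cup\mathcal M)$, $f\ge f^\star>-\infty$ on $\mathcal M\cup\widetilde{\mathcal M}$, and the approximate-retraction domain assumption (see context) holds with radius $Q$. For $p\in\mathcal M$ write $$E(p):=\big(2c_{\mathcal M}\|\nabla f(p)\|+c_{\widetilde{\mathcal M}}\|\nabla f(p)\|+c_f+c_{\mathrm{MMLS}}\big)\sqrt D\,h^m .$$ Consider the algorithm $x_{i+1}:=\widetilde R_{x_i}(\alpha_i\xi_{x_i})$ started at $x_0\in\widetilde{\mathcal M}$, with $p_i\in\mathcal M$ such that $\mathcal P_m^h(p_i)=x_i$, and $$\xi_{x_i}:=-\widetilde{\operatorname{grad}}f(x_i),\quad \alpha_i:=\min\left\{\frac{Q}{\|\widetilde{\operatorname{grad}}f(x_i)\|},\ \frac1{\widetilde L}\beta_i\right\}>0,\quad \beta_i:=1-\frac{E(p_i)}{\|\widetilde{\operatorname{grad}}f(x_i)\|}>0,$$ and suppose all iterations are performed at points of $\widetilde{\mathcal M}$ where $\widetilde{\mathcal M}$ is a manifold, $h$ is small enough such that $8L_v\le Q$, and $\max\{16\widetilde LL_v,\ 2E(p_i)\}\le\|\widetilde{\operatorname{grad}}f(x_i)\|$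 holds for all the iterations. Then for any $\varepsilon>0$, provided enough iterations are performed, the algorithm returns a point $x\in\widetilde{\mathcal M}$ such that, with $p\in\mathcal M$ satisfying $\mathcal P_m^h(p)=x$, $f(x)\le f(x_0)$ and $$\|\widetilde{\operatorname{grad}}f(x)\|\le\max\left\{16\widetilde LL_v,\ 2E(p)\right\}+\varepsilon=:\varepsilon_5(\widetilde{\mathcal M}).\tag{a}$$ In addition, $$\|\operatorname{grad}_{\mathcal M}f(p)\|\le(c_f+2c_{\mathcal M}G)\sqrt D\,h^m+\varepsilon_5(\widetilde{\mathcal M}),\tag{b}$$ where $\|\nabla f(p)\|\le G$, and $\|p-x\|\le c_{\mathrm{MMLS}}\sqrt D\,h^{m+1}$. Moreover, when $h\to0$ the bound in (b) goes to $\varepsilon$, and the quantities $8L_v$ and $\max\{16\widetilde LL_v,\ 2E(p_i)\}$ go to $0$. Finally, if $\varepsilon_5(\widetilde{\mathcal M})>2Q\widetilde L$, the bounds (a) and (b) are achieved in at most $$\left\lceil\frac{16(f(x_0)-f^\star)}{Q}\cdot\frac1{\varepsilon_5(\widetilde{\mathcal M})}\right\rceil$$ iterations, and if $\varepsilon_5(\widetilde{\mathcal M})\le2Q\widetilde L$, they are achieved in at most $$\left\lceil32(f(x_0)-f^\star)\widetilde L\cdot\frac1{\varepsilon_5(\widetilde{\mathcal M})^2}\right\rceil$$ iterations. Each iteration requires one cost and approximate-Riemannian gradient evaluation, and one approximate-retraction computation.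
   Context: Norms: $\|\cdot\|$ is the Euclidean norm on vectors and the spectral norm on matrices; $B_\delta(x)$ is the open ball; $\Pi_V$ is orthogonal projection onto $V$. ''Gradient $L$-Lipschitz on $\operatorname{Conv}(\widetilde{\mathcal M}\cup\mathcal M)$'' means $\|\nabla f(y)-\nabla f(x)\|\le L\|y-x\|$ for all $x,y$ in the convex hull of $\widetilde{\mathcal M}\cup\mathcal M$. $f:\mathbb R^D\to\mathbb R$ is sufficiently smooth. Setting. $\mathcal M$ ($\in C^2$) is a closed (compact, boundaryless) smooth $d$-dimensional submanifold of $\mathbb R^D$ with positive reach $\mathrm{rch}(\mathcal M)$ (the largest $\tau$ such that every point at distance $<\tau$ from $\mathcal M$ has a unique nearest point in $\mathcal M$). $S=\{r_i\}_{i=1}^n\subset\mathcal M$ is a quasi-uniform sample set with respect to $\mathcal M$: with fill distance $h=\sup_{x\in\mathcal M}\min_i\|x-r_i\|$ and separation radius $\delta_S=\tfrac12\min_{i\ne j}\|r_i-r_j\|$, one has $\delta_S\le h\le c_{qu}\delta_S$ for a constant $c_{qu}>0$. The samples $f(r_i)$ are given. The metric is the standard inner product of $\mathbb R^D$; $\operatorname{grad}_{\mathcal M}f(p)=\Pi_{T_p\mathcal M}(\nabla f(p))$, $\operatorname{grad}_{\widetilde{\mathcal M}}f(r)=\Pi_{T_r\widetilde{\mathcal M}}(\nabla f(r))$. MMLS projection of degree $m\ge1$. For $r\in\mathbb R^D$ close to $\mathcal M$: Step 1: $(q(r),H(r))$ minimizes $\sum_i d(r_i-q,H)^2\theta_1(\|r_i-q\|)$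 over $q\in\mathbb R^D$ and $d$-dimensional linear subspaces $H\subset\mathbb R^D$, subject to $r-q\perp H$, $q\in B_\mu(r)$, $S\cap B_h(q)\ne\emptyset$. Step 2: let $q_i$ be the orthogonal projection of $r_i-q(r)$ onto $H(r)\simeq\mathbb R^d$; $g^\star(\cdot\,|\,r):H(r)\to\mathbb R^D$ minimizes $\sum_i\|g(q_i)-r_i\|^2\theta_h(\|r_i-q(r)\|)$ over $\mathbb R^D$-valued polynomials of total degree at most $m$. Then $\mathcal P_m^h(r):=g^\star(0\,|\,r)$ and $\widetilde{\mathcal M}:=\{\mathcal P_m^h(p):p\in\mathcal M\}$. Weights: $\theta_1,\theta_h\ge0$, $\theta_h(th)=\Phi(t)$ for a fixed $\Phi$; they are smooth (away from singularities at $0$), monotonically decaying, supported on $[0,c_1h]$ with $c_1>3$, $\theta_1(c_2h)>c_3>0$ and $\theta_h(c_2h)>c_3>0$ for some constants $c_2<c_1$, $\lim_{t\to0}\theta_h(t)=\infty$, and $\mu=\mathrm{rch}(\mathcal M)/2$. It is assumed that there is an $\epsilon$-neighborhood of $\mathcal M$ on which the Step 1 problem has a unique local minimum $q(x)\in B_\mu(x)$; $U_{\mathrm{unique}}$ is the largest such neighborhood. $h$ is assumed small enough (including $hL\le1$) for the known facts: $\mathcal P_m^h:\mathcal M\to\widetilde{\mathcal M}$ is a bijection; $\widetilde{\mathcal M}$ is compact and almost everywhere a smooth $d$-dimensional manifold; $\mathcal P_m^h(U_{\mathrm{unique}})\subset\widetilde{\mathcal M}$; if $p\in\mathcal M$,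 $\mathcal P_m^h(p)=r$, then $q(r)=q(p)$, $H(r)=H(p)$, $g^\star(\cdot|r)=g^\star(\cdot|p)$, $\mathcal P_m^h(r)=r$. Local parametrizations: near $0\in H(p)$, $\varphi$ and $\widetilde\varphi$ are the local parametrizations of $\mathcal M$ and $\widetilde{\mathcal M}$ sending $x$ to the nearby point $y$ of the set for which $y-q(p)$ projects orthogonally onto $x$ in $H(p)$; $\varphi(0)=p$, $\widetilde\varphi(0)=\mathcal P_m^h(p)$. Function approximation: $\widehat f:=f\circ\varphi$ on $H(r)$; $p^f_r$ minimizes $\sum_i|p(q_i)-f(r_i)|^2\theta_3(\|r_i-q(r)\|)$ over real polynomials $p$ on $H(r)\simeq\mathbb R^d$ of total degree at most $m$, where $\theta_3\ge0$ is a $C^\infty$ weight (away from $0$), locally supported or rapidly decreasing, $\theta_3(th)=\Psi(t)$, $\lim_{t\to0}\theta_3(t)=\infty$. Constants (independent of $p$, $v$): $c_{\mathrm{MMLS}}$ satisfies $\|\mathcal P_m^h(p)-p\|\le c_{\mathrm{MMLS}}\sqrt D\,h^{m+1}$ for all $p\in\mathcal M$; $c_{\mathcal M},c_{\widetilde{\mathcal M}}$ satisfy, for all $p\in\mathcal M$, $x\in B_{c_1h}(0)\subset H(p)$, unit $v\in\mathbb R^d$: $\|\mathrm Dg^\star(x|p)[v]-\mathrm D\varphi(x)[v]\|_\infty\le c_{\mathcal M}h^m$ and $\|\mathrm Dg^\star(x|p)[v]-\mathrm D\widetilde\varphi(x)[v]\|_\infty\le c_{\widetilde{\mathcal M}}h^m$;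 $c_f$ satisfies $\|\nabla p^f_r(x)-\nabla\widehat f(x)\|_\infty\le c_fh^m$ for $x\in B_{c_1h}(0)\subset H(r)$. Approximate components: $\widetilde T_r\widetilde{\mathcal M}:=\operatorname{Range}(\mathrm Dg^\star(0\,|\,r))$ for $r\in\widetilde{\mathcal M}$; $\widetilde R_r(\xi):=\mathcal P_m^h(r+\xi)$ for $\xi\in\widetilde T_r\widetilde{\mathcal M}$. Approximate-retraction domain assumption: for each $r\in\widetilde{\mathcal M}$ there is $Q_r>0$ with $r+\xi\in U_{\mathrm{unique}}$ for all $\xi\in\widetilde T_r\widetilde{\mathcal M}$, $\|\xi\|\le Q_r$, and $Q:=\inf_rQ_r>0$; $K:=\{(r,\xi):r\in\widetilde{\mathcal M},\xi\in\widetilde T_r\widetilde{\mathcal M},\|\xi\|\le Q\}$ (compact). For $(r,\xi)\in K$, $\mathrm D\widetilde R_r(0_r)[\xi]=\xi+v'_{r,\xi}(0)\in T_r\widetilde{\mathcal M}$, where $v_{r,\xi}(t)\in H(r+t\xi)^\perp$ is smooth in $t$ near $0$ with $t\xi+v_{r,\xi}(t)\in T_r\widetilde{\mathcal M}$; $L_v>0$ is a constant with $\|v'_{r,\xi}(0)\|\le L_v$ on $K$, and $L_v\to0$ as $h\to0$. $\widetilde L>0$ is a constant with $|f(\widetilde R_r(\xi))-[f(r)+\langle\operatorname{grad}_{\widetilde{\mathcal M}}f(r),\xi+v'_{r,\xi}(0)\rangle]|\le\frac{\widetilde L}2\|\xi\|^2$ for all $(r,\xi)\in K$. $G$ is a finite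 bound of $\|\nabla f\|$ on $\mathcal M$.
   Formalization: As E(p) varies with p, the count is stated for the number ε₅ at the returned p: within that many iterations some iterate satisfies (a), (b) with this right-hand side; it is the returned point if ε₅ is no smaller at earlier iterates. The assumptions are required only of iterations before return. *)

(* Defs.v *)
From HB Require Import structures.
From mathcomp Require Import all_boot all_order all_algebra.
From mathcomp Require Import all_classical all_reals all_analysis.
(* The notations of mpoly clash with those of mathcomp-analysis. *)
From mathcomp Require Import -(notations) mpoly.

Set Implicit Arguments.
Unset Strict Implicit.
Unset Printing Implicit Defensive.

Import Order.TTheory GRing.Theory Num.Theory.
Import numFieldNormedType.Exports.

Local Open Scope classical_set_scope.
Local Open Scope ring_scope.

(* Points of R^D are row vectors. The library norm `|x| of a row vector is the
   sup norm; the Euclidean one is [enorm]. They induce the same topology, so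
   differentiability, compactness, etc. are the library's. *)
Section Euclidean.
Context {R : realType}.

Definition dot n (u v : 'rV[R]_n) : R := \sum_i u ord0 i * v ord0 i.
Definition enorm n (u : 'rV[R]_n) : R := Num.sqrt (dot u u).

Definition edist n (A : set 'rV[R]_n) (x : 'rV[R]_n) : R :=
  inf [set enorm (x - y) | y in A].

(* Meaningful when V is (the underlying set of) a linear subspace. *)
Definition orth_proj n (V : set 'rV[R]_n) (x : 'rV[R]_n) : 'rV[R]_n :=
  xget 0 [set y | V y /\ forall z, V z -> dot (x - y) z = 0].

Definition grad n (f : 'rV[R]_n -> R) (x : 'rV[R]_n) : 'rV[R]_n :=
  \row_j 'D_(delta_mx ord0 j) f x.

Definition conv_hull n (A : set 'rV[R]_n) : set 'rV[R]_n :=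
  smallest (@convex_set R 'rV[R]_n) A.

Definition grad_lipschitz_on n (A : set 'rV[R]_n) (L : R)
    (f : 'rV[R]_n -> R) : Prop :=
  forall x y, A x -> A y -> enorm (grad f y - grad f x) <= L * enorm (y - x).

(* Gap metric between linear subspaces. *)
Definition gap n (H K : {vspace 'rV[R]_n}) : R :=
  sup [set enorm (orth_proj [set` H] z - orth_proj [set` K] z)
      | z in [set z | enorm z <= 1]].

End Euclidean.

Section Smoothness.
Context {R : realType}.

Fixpoint Ck_on (V W : normedModType R) (k : nat) (U : set V) (f : V -> W) :
    Prop :=
  match k with
  | 0%N => forall x, U x -> {for x, continuous f}
  | k'.+1 => (forall x, U x -> differentiable f x) /\
             (forall v, Ck_on k' U (fun x => 'D_v f x))
  end.

(* Class C^r on the open set U; None stands for C^infinity. *)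
Definition Cr_on (V W : normedModType R) (r : option nat) (U : set V)
    (f : V -> W) : Prop :=
  forall k : nat, (if r is Some r' then (k <= r')%N else true) -> Ck_on k U f.

(* Near x, A is an embedded d-dimensional submanifold (without boundary) of
   class C^r: a regular level set of a submersion to R^(D-d). *)
Definition manifold_at D (r : option nat) (d : nat) (A : set 'rV[R]_D)
    (x : 'rV[R]_D) : Prop :=
  A x /\
  exists (c : nat) (U : set 'rV[R]_D) (F : 'rV[R]_D -> 'rV[R]_c),
    [/\ (d + c)%N = D, open U /\ U x, Cr_on r U F,
        forall y, U y -> \rank ('J F y) = c
      & A `&` U = [set y | U y /\ F y = 0]].

Definition tangent D (A : set 'rV[R]_D) (x : 'rV[R]_D) : set 'rV[R]_D :=
  [set v | exists c : R -> 'rV[R]_D,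
      [/\ c 0 = x, \forall t \near (0 : R), A (c t) & is_derive (0 : R) 1 c v]].

Definition rgrad D (A : set 'rV[R]_D) (f : 'rV[R]_D -> R) (x : 'rV[R]_D) :
    'rV[R]_D :=
  orth_proj (tangent A x) (grad f x).

(* Null sets of the s-dimensional Hausdorff measure, through countable covers
   by balls with arbitrarily small sum of s-th powers of radii. *)
Definition hausdorff_null D (s : nat) (A : set 'rV[R]_D) : Prop :=
  forall e : R, 0 < e ->
  exists (J : set nat) (c : nat -> 'rV[R]_D) (rad : nat -> R),
    [/\ forall i, 0 <= rad i,
        forall x, A x -> exists2 i, J i & enorm (x - c i) <= rad i
      & (\esum_(i in J) (rad i ^+ s)%:E <= e%:E)%E].

Definition reach D (A : set 'rV[R]_D) : \bar R :=
  ereal_sup [set t%:E | t in [set t | 0 < t /\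
    forall x, edist A x < t -> exists! y, A y /\ enorm (x - y) = edist A x]].

End Smoothness.

Section LeastSquares.
Context {R : realType}.

Definition is_min (T : Type) (C : set T) (J : T -> \bar R) (x : T) : Prop :=
  C x /\ forall y, C y -> (J x <= J y)%E.

Definition is_the_min (T : Type) (C : set T) (J : T -> \bar R) (x : T) : Prop :=
  is_min C J x /\ forall y, is_min C J y -> y = x.

Definition poly_fun d (m : nat) (p : 'rV[R]_d -> R) : Prop :=
  exists2 P : mpoly d R,
    {in msupp P, forall a, (mdeg a <= m)%N}
    & p = fun x => meval (fun i => x ord0 i) P.

Definition poly_map d D (m : nat) (g : 'rV[R]_d -> 'rV[R]_D) : Prop :=
  forall j, poly_fun m (fun x => g x ord0 j).

(* The weight s |-> Phi (s / h), infinite at 0. Since 0 * +oo = 0 in \bar R, a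
   finite weighted sum of squares forces interpolation at a site of infinite
   weight. *)
Definition wt (Phi : R -> R) (h s : R) : \bar R :=
  if s == 0 then +oo%E else (Phi (s / h))%:E.

(* Values at 0 are never used. *)
Definition mls_weight (c1 c2 c3 h : R) (theta : R -> R) : Prop :=
  [/\ forall s, 0 < s -> 0 <= theta s,
      Cr_on None [set s : R | 0 < s] (theta : R -> R),
      forall s t, 0 < s -> s <= t -> theta t <= theta s,
      forall s, c1 * h < s -> theta s = 0
    & c3 < theta (c2 * h)].

End LeastSquares.

(* The data that do not depend on the sample set, so in particular not on h. *)
Record setting (R : realType) (D d : nat) := Setting {
  man : set 'rV[R]_D ;
  fn : 'rV[R]_D -> R ;
  deg : nat ;
  (* rows of [frame H]: an orthonormal basis of H, i.e. H ~ R^d *)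
  frame : {vspace 'rV[R]_D} -> 'M[R]_(d, D) ;
  Phi : R -> R ;
  Psi : R -> R ;
  cqu : R ; c1 : R ; c2 : R ; c3 : R ;
  cMMLS : R ; cM : R ; cMt : R ; cf : R ;
  Lip : R ; Ltil : R ; Gbd : R
}.

(* A sample set with fill distance [fill] (the h of the text) and what is built
   on it. *)
Record level (R : realType) (D d : nat) := Level {
  fill : R ;
  nsmp : nat ;
  smp : 'I_nsmp -> 'rV[R]_D ;
  theta1 : R -> R ;
  qpt : 'rV[R]_D -> 'rV[R]_D ;                    (* q(r) *)
  Hsp : 'rV[R]_D -> {vspace 'rV[R]_D} ;           (* H(r) *)
  gst : 'rV[R]_D -> 'rV[R]_d -> 'rV[R]_D ;        (* g*(.|r), via the frame *)
  pfn : 'rV[R]_D -> 'rV[R]_d -> R ;               (* p^f_r, via the frame *)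
  phi : 'rV[R]_D -> 'rV[R]_d -> 'rV[R]_D ;        (* phi at p *)
  phit : 'rV[R]_D -> 'rV[R]_d -> 'rV[R]_D ;       (* phi tilde at p *)
  vfn : 'rV[R]_D -> 'rV[R]_D -> R -> 'rV[R]_D ;   (* v_{r,xi}(t) *)
  Lv : R ;
  Qrad : R ;
  fstar : R
}.

Section MMLS.
Context {R : realType} {D d : nat}.
Implicit Types (P : setting R D d) (X : level R D d).
Local Notation E := 'rV[R]_D.
Local Notation rtD := (Num.sqrt (D%:R : R)).

Definition fill_distance (M : set E) n (r : 'I_n -> E) : R :=
  sup [set inf [set enorm (x - r i) | i in [set: 'I_n]] | x in M].

Definition separation_radius n (r : 'I_n -> E) : R :=
  2^-1 * inf [set enorm (r ij.1 - r ij.2)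
             | ij in [set ij : 'I_n * 'I_n | ij.1 != ij.2]].

Definition quasi_uniform P X : Prop :=
  [/\ injective (@smp _ _ _ X), forall i, man P (@smp _ _ _ X i),
      fill X = fill_distance (man P) (@smp _ _ _ X),
      separation_radius (@smp _ _ _ X) <= fill X
    & fill X <= cqu P * separation_radius (@smp _ _ _ X)].

Definition mu P : \bar R := (reach (man P) * (2^-1)%:E)%E.

Definition step1_feasible P X (r : E) : set (E * {vspace E}) :=
  [set qH | [/\ \dim qH.2 = d, forall z, z \in qH.2 -> dot (r - qH.1) z = 0,
      ((enorm (qH.1 - r))%:E < mu P)%E
    & exists i, enorm (@smp _ _ _ X i - qH.1) < fill X]].

Definition step1_cost X (qH : E * {vspace E}) : R :=
  \sum_(i < nsmp X) edist [set` qH.2] (@smp _ _ _ X i - qH.1) ^+ 2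
                    * theta1 X (enorm (@smp _ _ _ X i - qH.1)).

Definition step1_local_min P X (r : E) (qH : E * {vspace E}) : Prop :=
  step1_feasible P X r qH /\
  exists2 e : R, 0 < e &
    forall qH', step1_feasible P X r qH' ->
      enorm (qH'.1 - qH.1) < e -> gap qH'.2 qH.2 < e ->
      step1_cost X qH <= step1_cost X qH'.

Definition step1_unique P X : set E :=
  [set r | exists! qH, step1_local_min P X r qH].

Definition nbhd_of (A : set E) (e : R) : set E := [set x | edist A x < e].

Definition Uunique P X : set E :=
  [set x | exists e : R,
    [/\ 0 < e, nbhd_of (man P) e `<=` step1_unique P X & nbhd_of (man P) e x]].

(* Coordinates, in the frame of H(r), of the projection of y - q(r) on H(r). *)
Definition coordH P X (r y : E) : 'rV[R]_d :=
  (y - qpt X r) *m (frame P (Hsp X r))^T.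

Definition step2_cost P X (r : E) (g : 'rV[R]_d -> E) : \bar R :=
  (\sum_(i < nsmp X)
    (enorm (g (coordH P X r (@smp _ _ _ X i)) - @smp _ _ _ X i) ^+ 2)%:E
    * wt (Phi P) (fill X) (enorm (@smp _ _ _ X i - qpt X r)))%E.

Definition fit_cost P X (r : E) (p : 'rV[R]_d -> R) : \bar R :=
  (\sum_(i < nsmp X)
    (`|p (coordH P X r (@smp _ _ _ X i)) - fn P (@smp _ _ _ X i)| ^+ 2)%:E
    * wt (Psi P) (fill X) (enorm (@smp _ _ _ X i - qpt X r)))%E.

Definition mmls X (r : E) : E := gst X r 0.

Definition Mtil P X : set E := mmls X @` man P.

(* phi parametrizes A over the ball of radius rho of H: phi x is the point y of
   A near y0 for which y - q projects on x; B is the frame of H. *)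
Definition local_param (r : option nat) (A : set E) (q y0 : E)
    (B : 'M[R]_(d, D)) (rho : R) (ph : 'rV[R]_d -> E) : Prop :=
  [/\ ph 0 = y0,
      forall x, enorm x < rho -> A (ph x) /\ (ph x - q) *m B^T = x,
      forall x, enorm x < rho -> {for x, continuous ph},
      forall x, enorm x < rho -> manifold_at r d A (ph x) ->
        differentiable ph x
    & exists2 e : R, 0 < e &
        forall y, A y -> enorm (y - y0) < e -> ph ((y - q) *m B^T) = y].

(* Jacobians of row-vector maps act on the right: [Jg] is the transpose
   of Dg*(0|r), and [agrad] that of Dg*(0|r) G_r^-1 grad p^f_r(0). *)
Definition Jg X (r : E) : 'M[R]_(d, D) := 'J (gst X r) 0.

Definition agrad X (r : E) : E :=
  grad (pfn X r) 0 *m invmx (Jg X r *m (Jg X r)^T) *m Jg X r.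

Definition atangent X (r : E) : set E := [set u *m Jg X r | u in setT].

Definition aretr X (r xi : E) : E := mmls X (r + xi).

Definition Kset P X : set (E * E) :=
  [set rx | [/\ Mtil P X rx.1, atangent X rx.1 rx.2 & enorm rx.2 <= Qrad X]].

Definition Eerr P X (p : E) : R :=
  (2 * cM P * enorm (grad (fn P) p) + cMt P * enorm (grad (fn P) p)
   + cf P + cMMLS P) * rtD * fill X ^+ deg P.

Definition floor_term P X (p : E) : R :=
  Num.max (16 * Ltil P * Lv X) (2 * Eerr P X p).

Definition eps5 P X (eps : R) (p : E) : R := floor_term P X p + eps.

(* Right-hand side of the bound on the Riemannian gradient on M, for a bound
   [e] on the norm of the approximate gradient. *)
Definition grad_bound P X (e : R) : R :=
  (cf P + 2 * cM P * Gbd P) * rtD * fill X ^+ deg P + e.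

Definition setting_ok P : Prop :=
  [/\ compact (man P) /\ (forall x, man P x -> manifold_at (Some 2%N) d (man P) x),
      (0 < reach (man P))%E /\ (1 <= deg P)%N,
      Cr_on (Some 1%N) setT (fn P),
      (forall H, \dim H = d -> frame P H *m (frame P H)^T = 1%:M /\
         forall i, row i (frame P H) \in H)
    & [/\ [/\ 0 < cqu P, 3 < c1 P, 0 < c2 P < c1 P & 0 < c3 P],
        mls_weight (c1 P) (c2 P) (c3 P) 1 (Phi P)
          /\ Phi P t @[t --> (0 : R)^'+] --> +oo,
        [/\ forall t, 0 < t -> 0 <= Psi P t,
            Cr_on None [set t : R | 0 < t] (Psi P : R -> R),
            (exists T : R, forall t, T < t -> Psi P t = 0) \/
            (forall k : nat, t ^+ k * Psi P t @[t --> +oo] --> (0 : R))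
          & Psi P t @[t --> (0 : R)^'+] --> +oo],
        [/\ 0 <= cMMLS P, 0 <= cM P, 0 <= cMt P, 0 <= cf P & 0 < Ltil P]
      & forall p, man P p -> enorm (grad (fn P) p) <= Gbd P]].

(* g* is used as a function of r, so it is required to be the unique minimizer;
   uniqueness in the first step is the definition of [Uunique]. *)
Definition mmls_solutions P X : Prop :=
  [/\ exists2 e : R, 0 < e & nbhd_of (man P) e `<=` step1_unique P X,
      forall r, Uunique P X r ->
        is_min (step1_feasible P X r) (fun qH => (step1_cost X qH)%:E)
               (qpt X r, Hsp X r),
      forall r, Uunique P X r ->
        is_the_min (poly_map (deg P)) (step2_cost P X r) (gst X r)
    & forall r, Mtil P X r ->
        is_min (poly_fun (deg P)) (fit_cost P X r) (pfn X r)].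

Definition mmls_facts P X : Prop :=
  [/\ fill X * Lip P <= 1,
      set_bij (man P) (Mtil P X) (mmls X),
      compact (Mtil P X) /\
      hausdorff_null d [set x | Mtil P X x /\ ~ manifold_at None d (Mtil P X) x],
      mmls X @` Uunique P X `<=` Mtil P X
    & forall p, man P p -> let r := mmls X p in
        [/\ qpt X r = qpt X p, Hsp X r = Hsp X p, gst X r = gst X p
          & mmls X r = r]].

Definition mmls_constants P X : Prop :=
  forall p, man P p ->
  [/\ local_param (Some 2%N) (man P) (qpt X p) p (frame P (Hsp X p))
        (c1 P * fill X) (phi X p),
      local_param None (Mtil P X) (qpt X p) (mmls X p) (frame P (Hsp X p))
        (c1 P * fill X) (phit X p),
      enorm (mmls X p - p) <= cMMLS P * rtD * fill X ^+ (deg P).+1,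
      (forall x v, enorm x < c1 P * fill X -> enorm v = 1 ->
        `| 'd (gst X p) x v - 'd (phi X p) x v | <= cM P * fill X ^+ deg P) /\
      (forall x v, enorm x < c1 P * fill X -> enorm v = 1 ->
        manifold_at None d (Mtil P X) (phit X p x) ->
        `| 'd (gst X p) x v - 'd (phit X p) x v | <= cMt P * fill X ^+ deg P)
    & forall x, enorm x < c1 P * fill X ->
        `| grad (pfn X (mmls X p)) x - grad (fn P \o phi X p) x |
          <= cf P * fill X ^+ deg P].

Definition level_ok P X : Prop :=
  [/\ 0 < fill X, quasi_uniform P X,
      mls_weight (c1 P) (c2 P) (c3 P) (fill X) (theta1 X),
      mmls_solutions P X
    & mmls_facts P X /\ mmls_constants P X].

Definition retraction_domain P X : Prop :=
  0 < Qrad X /\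
  exists Qr : E -> R, Qrad X = inf (Qr @` Mtil P X) /\
    forall r, Mtil P X r -> 0 < Qr r /\
      forall xi, atangent X r xi -> enorm xi <= Qr r -> Uunique P X (r + xi).

Definition retraction_expansion P X : Prop :=
  0 < Lv X /\
  forall r xi, Kset P X (r, xi) -> manifold_at None d (Mtil P X) r ->
  let v := vfn X r xi in
  let xi' := xi + derive1 v 0 in
  [/\ exists2 e : R, 0 < e &
        Cr_on None [set t : R | `|t| < e] v /\
        forall t, `|t| < e ->
          (forall z, z \in Hsp X (r + t *: xi) -> dot (v t) z = 0) /\
          tangent (Mtil P X) r (t *: xi + v t),
      is_derive (0 : R) 1 (fun t : R => aretr X r (t *: xi)) xi',
      tangent (Mtil P X) r xi',
      enorm (derive1 v 0) <= Lv X
    & `| fn P (aretr X r xi)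
         - (fn P r + dot (rgrad (Mtil P X) (fn P) r) xi') |
        <= Ltil P / 2 * enorm xi ^+ 2].

Definition beta (err : R) (g : E) : R := 1 - err / enorm g.

Definition alpha (Q Lt err : R) (g : E) : R :=
  Num.min (Q / enorm g) (Lt^-1 * beta err g).

Definition performed P X (x p : nat -> E) (j : nat) : Prop :=
  let g := agrad X (x j) in
  let err := Eerr P X (p j) in
  [/\ manifold_at None d (Mtil P X) (x j),
      0 < beta err g, 0 < alpha (Qrad X) (Ltil P) err g,
      floor_term P X (p j) <= enorm g
    & x j.+1 = aretr X (x j) (alpha (Qrad X) (Ltil P) err g *: - g)].

Definition gradient_reached P X (eps : R) (x p : E) : Prop :=
  enorm (agrad X x) <= eps5 P X eps p.

End MMLS.

(* Computations with access to three oracles -- cost, approximate gradient,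
   approximate retraction -- whose calls are counted, in this order. *)
Inductive oracle_prog (R V A : Type) : Type :=
| Return of A
| AskCost of V & (R -> oracle_prog R V A)
| AskGrad of V & (V -> oracle_prog R V A)
| AskRetr of V & V & (V -> oracle_prog R V A).

Fixpoint exec (R V A : Type) (cost : V -> R) (gr : V -> V) (retr : V -> V -> V)
    (c : oracle_prog R V A) : A * (nat * nat * nat) :=
  match c with
  | Return a => (a, (0, 0, 0)%N)
  | AskCost x k =>
      let: (a, (i, j, l)) := exec cost gr retr (k (cost x)) in
      (a, (i.+1, j, l))
  | AskGrad x k =>
      let: (a, (i, j, l)) := exec cost gr retr (k (gr x)) in
      (a, (i, j.+1, l))
  | AskRetr x xi k =>
      let: (a, (i, j, l)) := exec cost gr retr (k (retr x xi)) in
      (a, (i, j, l.+1))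
  end.

(* One iteration: reports the cost at x and moves to the next iterate. *)
Definition iteration (R : realType) (D : nat) (Q Lt err : R) (x : 'rV[R]_D) :
    oracle_prog R 'rV[R]_D (R * 'rV[R]_D) :=
  AskCost x (fun c =>
  AskGrad x (fun g =>
  AskRetr x (alpha Q Lt err g *: - g) (fun y => Return _ _ (c, y)))).

(* Main.v *)
Require Import Defs.
From HB Require Import structures.
From mathcomp Require Import all_boot all_order all_algebra.
From mathcomp Require Import all_classical all_reals all_analysis.
From mathcomp Require Import -(notations) mpoly.
From mathcomp Require Import ring lra.

Import Order.TTheory GRing.Theory Num.Theory.
Import numFieldNormedType.Exports.

Local Open Scope classical_set_scope.
Local Open Scope ring_scope.

(** Let [p] be a point of the manifold and [r] its projection. The differentials
    at the origin of g*, of the parametrization of the manifold near [p] and of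
    that of the approximating set near [r] are matrices [J], [Jphi] and [Jt]
    that act on row vectors of coordinates in the common plane H(p) = H(r), and
    they differ by O(h^m).

    Gradient error. Taking coordinates in H(p) undoes each of the three maps: by
    definition for the parametrizations, and for g* because the component of a
    least squares fit along H(p) can be chosen exact, so that the only minimizer
    has it exact ([gst_section]). Coordinates in an orthonormal frame do not
    increase norms, hence [J], [Jphi] and [Jt] do not decrease them
    ([section_expanding]). Two consequences carry the estimates. The
    pseudo-inverse that turns partial derivatives into a vector has norm at most
    1 ([pinv_le]), and when two such maps differ by at most [c], so do the
    orthogonal projections on their ranges ([orth_proj_gap]). As the ranges of
    [Jphi] and [Jt] are the tangent spaces ([tangent_local_param]), the
    approximate gradient is within E(p) of the Riemannian gradient on the
    approximating set ([rgrad_Mtil_close]), and its norm bounds that of the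
    Riemannian gradient on the manifold up to O(h^m) ([rgrad_man_le]).

    Descent. Put the first bound in the expansion of the cost along the
    approximate retraction. With an approximate gradient of norm [N], the step
    length makes the quadratic model decrease by at least Q N / 4 or
    N^2 / (8 Lt), according to which term of its minimum is active; the lower
    bound on [N] leaves a quarter of that after the error of the retraction. So
    each step gains min (Q N / 16, N^2 / (32 Lt)) ([step_decrease]).

    Counting. Before the tolerance is reached [N] exceeds [eps], and the cost is
    bounded below, so the tolerance is reached. The bounds on the number of
    iterations are for the tolerance [e] at the last point, while the earlier
    iterates were tested against their own one; thus the index to count is the
    first one with N <= [e] ([iteration_count]), before which every step gains
    at least min (Q e / 16, e^2 / (32 Lt)). The two bounds are the two values of
    this minimum.

    As h tends to 0, E(p) is at most a constant times h^m, which gives the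
    limits. *)

Set Implicit Arguments.
Unset Strict Implicit.

(** * The Euclidean norm *)

Section Euclid.
Context {R : realType}.

Lemma dot_mul n (u v : 'rV[R]_n) : dot u v = (u *m v^T) ord0 ord0.
Proof. by rewrite mxE; apply: eq_bigr => i _; rewrite mxE. Qed.

Lemma dotC n (u v : 'rV[R]_n) : dot u v = dot v u.
Proof. by apply: eq_bigr => i _; rewrite mulrC. Qed.

Lemma dotDl n (u v w : 'rV[R]_n) : dot (u + v) w = dot u w + dot v w.
Proof. by rewrite !dot_mul mulmxDl mxE. Qed.

Lemma dotNl n (u v : 'rV[R]_n) : dot (- u) v = - dot u v.
Proof. by rewrite !dot_mul mulNmx mxE. Qed.

Lemma dotBl n (u v w : 'rV[R]_n) : dot (u - v) w = dot u w - dot v w.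
Proof. by rewrite dotDl dotNl. Qed.

Lemma dotZl n a (u v : 'rV[R]_n) : dot (a *: u) v = a * dot u v.
Proof. by rewrite !dot_mul -scalemxAl mxE. Qed.

Lemma dotDr n (u v w : 'rV[R]_n) : dot u (v + w) = dot u v + dot u w.
Proof. by rewrite dotC dotDl !(dotC _ u). Qed.

Lemma dotNr n (u v : 'rV[R]_n) : dot u (- v) = - dot u v.
Proof. by rewrite dotC dotNl dotC. Qed.

Lemma dotBr n (u v w : 'rV[R]_n) : dot u (v - w) = dot u v - dot u w.
Proof. by rewrite dotDr dotNr. Qed.

Lemma dotZr n a (u v : 'rV[R]_n) : dot u (a *: v) = a * dot u v.
Proof. by rewrite dotC dotZl dotC. Qed.

Lemma dot0l n (v : 'rV[R]_n) : dot 0 v = 0.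
Proof. by rewrite dot_mul mul0mx mxE. Qed.

Lemma dot_mulmxl m n (u : 'rV[R]_m) (A : 'M[R]_(m, n)) v :
  dot (u *m A) v = dot u (v *m A^T).
Proof. by rewrite !dot_mul trmx_mul trmxK mulmxA. Qed.

Lemma dot_ge0 n (u : 'rV[R]_n) : 0 <= dot u u.
Proof. by apply: sumr_ge0 => i _; rewrite -expr2 sqr_ge0. Qed.

Lemma enorm_ge0 n (u : 'rV[R]_n) : 0 <= enorm u.
Proof. exact: sqrtr_ge0. Qed.

Lemma sqr_enorm n (u : 'rV[R]_n) : enorm u ^+ 2 = dot u u.
Proof. by rewrite sqr_sqrtr ?dot_ge0. Qed.

Lemma dot_eq0 n (u : 'rV[R]_n) : dot u u = 0 -> u = 0.
Proof.
move=> /eqP; rewrite psumr_eq0; last by move=> i _; rewrite -expr2 sqr_ge0.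
move=> /allP u0; apply/rowP => j; rewrite mxE.
by have := u0 j (mem_index_enum _); rewrite -expr2 sqrf_eq0 => /eqP.
Qed.

Lemma enorm_eq0 n (u : 'rV[R]_n) : enorm u = 0 -> u = 0.
Proof. by move=> u0; apply: dot_eq0; rewrite -sqr_enorm u0 expr0n. Qed.

Lemma enorm0 n : enorm (0 : 'rV[R]_n) = 0.
Proof. by rewrite /enorm dot0l sqrtr0. Qed.

Lemma enormN n (u : 'rV[R]_n) : enorm (- u) = enorm u.
Proof. by rewrite /enorm dotNl dotNr opprK. Qed.

Lemma enormBC n (u v : 'rV[R]_n) : enorm (u - v) = enorm (v - u).
Proof. by rewrite -opprB enormN. Qed.

Lemma enormZ n a (u : 'rV[R]_n) : enorm (a *: u) = `|a| * enorm u.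
Proof.
by rewrite /enorm dotZl dotZr mulrA -expr2 sqrtrM ?sqr_ge0// sqrtr_sqr.
Qed.

Lemma pythagoras n (u v : 'rV[R]_n) : dot u v = 0 ->
  dot (u + v) (u + v) = enorm u ^+ 2 + enorm v ^+ 2.
Proof.
by move=> uv; rewrite dotDl !dotDr (dotC v u) uv addr0 add0r !sqr_enorm.
Qed.

Lemma enorm_le_sqr n (u : 'rV[R]_n) c :
  0 <= c -> dot u u <= c ^+ 2 -> enorm u <= c.
Proof. by move=> c0; rewrite -sqr_enorm ler_sqr ?nnegrE ?enorm_ge0. Qed.

Lemma enorm_le_self n (u : 'rV[R]_n) c :
  0 <= c -> dot u u <= c * enorm u -> enorm u <= c.
Proof.
move=> c0; rewrite -sqr_enorm expr2.
have [->//|u0] := eqVneq (enorm u) 0.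
by rewrite ler_pM2r// lt_def u0 enorm_ge0.
Qed.

Lemma dot_le n (u v : 'rV[R]_n) : dot u v <= enorm u * enorm v.
Proof.
have [v0|v0] := eqVneq (enorm v) 0.
  by rewrite (enorm_eq0 v0) dotC dot0l enorm0 mulr0.
have [u0|u0] := eqVneq (enorm u) 0.
  by rewrite (enorm_eq0 u0) dot0l enorm0 mul0r.
have up : 0 < enorm u by rewrite lt_def u0 enorm_ge0.
have vp : 0 < enorm v by rewrite lt_def v0 enorm_ge0.
have := dot_ge0 (enorm v *: u - enorm u *: v).
rewrite dotBl !dotBr !(dotZl, dotZr) -!sqr_enorm (dotC v u) => H.
have : 0 <= (enorm u * enorm v) * (enorm u * enorm v - dot u v) by lra.
by rewrite pmulr_rge0 ?mulr_gt0// subr_ge0.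
Qed.

Lemma enormD n (u v : 'rV[R]_n) : enorm (u + v) <= enorm u + enorm v.
Proof.
apply: enorm_le_sqr; first by rewrite addr_ge0 ?enorm_ge0.
rewrite dotDl !dotDr -!sqr_enorm (dotC v u) sqrrD.
have := dot_le u v; lra.
Qed.

Lemma enorm_le_sup n (u : 'rV[R]_n) : enorm u <= Num.sqrt n%:R * `|u|.
Proof.
apply: enorm_le_sqr; first by rewrite mulr_ge0 ?sqrtr_ge0.
rewrite exprMn sqr_sqrtr ?ler0n// /dot.
have -> : n%:R * `|u| ^+ 2 = \sum_(i < n) `|u| ^+ 2.
  by rewrite sumr_const card_ord mulr_natl.
apply: ler_sum => i _; rewrite -expr2 -real_normK ?num_real//.
rewrite ler_sqr ?nnegrE//.
rewrite [leRHS]/Num.Def.normr/= mx_normrE.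
exact: (le_bigmax _ (fun ij : 'I_1 * 'I_n => `|u ij.1 ij.2|) (ord0, i)).
Qed.

(** Comparing with unit vectors only suffices, by homogeneity. *)
Lemma enorm_mulmx_le m n (A : 'M[R]_(m, n)) c u : 0 <= c ->
  (forall v, enorm v = 1 -> `|v *m A| <= c) ->
  enorm (u *m A) <= Num.sqrt n%:R * c * enorm u.
Proof.
move=> c0 H; have [u0|u0] := eqVneq (enorm u) 0.
  by rewrite (enorm_eq0 u0) mul0mx !enorm0 mulr0.
have up : 0 < enorm u by rewrite lt_def u0 enorm_ge0.
pose v := (enorm u)^-1 *: u.
have v1 : enorm v = 1 by rewrite enormZ ger0_norm ?invr_ge0 ?enorm_ge0// mulVf.
have -> : u *m A = enorm u *: (v *m A).
  by rewrite -scalemxAl scalerA divff// scale1r.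
rewrite enormZ ger0_norm ?enorm_ge0// mulrC ler_pM2r//.
by rewrite (le_trans (enorm_le_sup _))// ler_wpM2l ?sqrtr_ge0 ?H.
Qed.

(** Each of two candidates is tested against both of them, which makes the
    square of their difference vanish. *)
Lemma orth_projP n (V : set 'rV[R]_n) x y :
  V y -> (forall z, V z -> dot (x - y) z = 0) -> orth_proj V x = y.
Proof.
move=> Vy oy; apply: xget_unique => // z [Vz oz].
apply/eqP; rewrite -subr_eq0; apply/eqP/dot_eq0.
have : dot (z - y) (z - y) = dot (x - y) z - dot (x - y) y
    - (dot (x - z) z - dot (x - z) y).
  by rewrite !(dotBl, dotBr); ring.
by rewrite oy// oy// oz// oz// !subr0.
Qed.
End Euclid.

(** * Projections on the range of a map that does not decrease norms *)

Section Projection.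
Context {R : realType} {d D : nat}.
Implicit Types (J B : 'M[R]_(d, D)) (w u : 'rV[R]_d) (x y : 'rV[R]_D).

Definition row_space J : set 'rV[R]_D := [set u *m J | u in setT].

(** A quantitative form of injectivity: the least singular value of [J] is at
    least 1. *)
Definition expanding J := forall u, enorm u <= enorm (u *m J).

(** [pinv J w] is the least-norm solution [y] of [y *m J^T = w], i.e. the
    pseudo-inverse of [J^T] applied to [w]. *)
Definition pinv J w := w *m invmx (J *m J^T) *m J.

Lemma coord_le B y : B *m B^T = 1%:M -> enorm (y *m B^T) <= enorm y.
Proof.
move=> BB; apply: enorm_le_self; first exact: enorm_ge0.
rewrite dot_mulmxl trmxK (le_trans (dot_le _ _))//.
rewrite /enorm (dot_mulmxl (y *m B^T)) -(mulmxA _ B) BB mulmx1.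
by rewrite dot_mulmxl trmxK.
Qed.

(** Undoing [J] by the coordinates in an orthonormal frame does not increase
    norms, hence [J] does not decrease them. *)
Lemma section_expanding B J :
  B *m B^T = 1%:M -> J *m B^T = 1%:M -> expanding J.
Proof.
by move=> BB JB u; have := coord_le (u *m J) BB; rewrite -mulmxA JB mulmx1.
Qed.

Lemma gram_unit J : expanding J -> J *m J^T \in unitmx.
Proof.
move=> eJ; rewrite -row_free_unit; apply: inj_row_free => u u0.
apply: enorm_eq0; apply/le_anti; rewrite enorm_ge0 (le_trans (eJ u))//.
by rewrite /enorm dot_mulmxl -mulmxA u0 dotC dot0l sqrtr0.
Qed.

Lemma pinvK J w : expanding J -> pinv J w *m J^T = w.
Proof. by move=> eJ; rewrite -mulmxA mulmxKV// gram_unit. Qed.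

Lemma pinvB J w w' : pinv J w - pinv J w' = pinv J (w - w').
Proof. by rewrite /pinv !mulmxBl. Qed.

Lemma pinv_le J w : expanding J -> enorm (pinv J w) <= enorm w.
Proof.
move=> eJ; apply: enorm_le_self; first exact: enorm_ge0.
rewrite {2}/pinv dotC dot_mulmxl pinvK// dotC (le_trans (dot_le _ _))//.
by rewrite ler_wpM2l ?enorm_ge0.
Qed.

Lemma row_spaceP J x y : row_space J y -> (x - y) *m J^T = 0 ->
  orth_proj (row_space J) x = y.
Proof.
move=> Jy xy; apply: orth_projP => // _ [u _ <-].
by rewrite dotC dot_mulmxl xy dotC dot0l.
Qed.

Lemma orth_proj_row_space J x : expanding J ->
  orth_proj (row_space J) x = pinv J (x *m J^T).
Proof.
move=> eJ; apply: row_spaceP; first by eexists.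
by rewrite mulmxBl pinvK// subrr.
Qed.

Lemma orth_proj_row_space_le J x y : expanding J ->
  enorm (orth_proj (row_space J) x - orth_proj (row_space J) y)
    <= enorm (x - y).
Proof.
move=> eJ; rewrite !orth_proj_row_space// pinvB -mulmxBl.
apply: enorm_le_self; first exact: enorm_ge0.
rewrite {2}/pinv dotC dot_mulmxl pinvK// -dot_mulmxl dotC.
exact: dot_le.
Qed.

(** A matrix and its transpose have the same operator norm. *)
Lemma trmx_close J1 J2 c x : 0 <= c ->
  (forall u, enorm (u *m J1 - u *m J2) <= c * enorm u) ->
  enorm (x *m J1^T - x *m J2^T) <= c * enorm x.
Proof.
move=> c0 J12; rewrite -mulmxBr -linearB/=; set A := J1 - J2.
apply: enorm_le_self; first by rewrite mulr_ge0 ?enorm_ge0.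
rewrite dot_mulmxl trmxK (le_trans (dot_le _ _))//.
rewrite mulrAC mulrC ler_wpM2r ?enorm_ge0//.
by rewrite /A mulmxBr J12.
Qed.

(** If [P1] and [P2] are the projections, [P1 - P2] is the difference of
    [P1 (1 - P2)] and [(1 - P1) P2], whose values are orthogonal to each other;
    since [1 - P2] kills the range of [J2], and [1 - P1] that of [J1], both are
    small when [J1] and [J2] are close. *)
Lemma orth_proj_gap J1 J2 c x : 0 <= c -> expanding J1 -> expanding J2 ->
  (forall u, enorm (u *m J1 - u *m J2) <= c * enorm u) ->
  enorm (orth_proj (row_space J1) x - orth_proj (row_space J2) x)
    <= c * enorm x.
Proof.
move=> c0 e1 e2 J12; rewrite !orth_proj_row_space//.
set y1 := pinv J1 _; set u2 := x *m J2^T *m invmx (J2 *m J2^T).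
set y2 := pinv J2 _; have y2E : y2 = u2 *m J2 by [].
pose z := x - y2; pose a := pinv J1 (z *m J1^T).
pose b := y2 - pinv J1 (y2 *m J1^T).
have aE : a = y1 - pinv J1 (y2 *m J1^T) by rewrite pinvB /a -mulmxBl.
have y12 : y1 - y2 = a - b.
  by rewrite aE /b opprB addrA subrK.
have zJ2 : z *m J2^T = 0 by rewrite mulmxBl pinvK// subrr.
have bJ1 : b *m J1^T = 0 by rewrite mulmxBl pinvK// subrr.
have orth J v u : v *m J^T = 0 -> dot v (u *m J) = 0.
  by move=> vJ; rewrite dotC dot_mulmxl vJ dotC dot0l.
have xx : dot x x = enorm z ^+ 2 + enorm y2 ^+ 2.
  by rewrite -pythagoras ?subrK// y2E orth.
have b_le : enorm b <= c * enorm y2.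
  have bb : dot b b = dot b (u2 *m J2 - u2 *m J1).
    rewrite [RHS]dotBr [dot b (u2 *m J1)]orth// -y2E.
    by rewrite {2}/b [LHS]dotBr [X in _ - X]orth.
  apply: enorm_le_self; first by rewrite mulr_ge0 ?enorm_ge0.
  rewrite bb (le_trans (dot_le _ _))// mulrC ler_wpM2r ?enorm_ge0//.
  by rewrite enormBC (le_trans (J12 _))// ler_wpM2l// y2E e2.
have a_le : enorm a <= c * enorm z.
  pose u := z *m J1^T *m invmx (J1 *m J1^T).
  have aa : dot a a = dot z (u *m J1 - u *m J2).
    rewrite dotBr [X in _ - X]orth// subr0.
    have : dot (z - a) (u *m J1) = 0.
      by rewrite orth// mulmxBl pinvK// subrr.
    by rewrite dotBl => /eqP; rewrite subr_eq0 => /eqP ->.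
  apply: enorm_le_self; first by rewrite mulr_ge0 ?enorm_ge0.
  rewrite aa (le_trans (dot_le _ _))//.
  rewrite (le_trans (ler_wpM2l (enorm_ge0 z) (J12 u)))//.
  by rewrite mulrCA -mulrA !ler_wpM2l ?enorm_ge0// e1.
rewrite y12; apply: enorm_le_sqr; first by rewrite mulr_ge0 ?enorm_ge0.
rewrite pythagoras; last by rewrite dotNr dotC orth// oppr0.
rewrite enormN.
rewrite exprMn (sqr_enorm x) xx mulrDr -!exprMn lerD// ler_sqr ?nnegrE//;
  by rewrite ?mulr_ge0 ?enorm_ge0.
Qed.

End Projection.

(** * Differentials in coordinates *)

Section Calculus.
Context {R : realType}.

Lemma differentiable_row (V : normedModType R) n (g : V -> 'rV[R]_n) x :
  (forall j, differentiable (fun y => g y ord0 j : R) x) -> differentiable g x.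
Proof.
move=> dg.
have -> : g = \sum_(j < n)
    (fun y => (g y ord0 j : R) *: (delta_mx ord0 j : 'rV[R]_n)).
  apply/funext => y; rewrite [LHS]row_sum_delta fct_sumE.
  by apply: eq_bigr.
apply: differentiable_sum => j; exact: differentiableZl.
Qed.

Lemma differentiable_mulmxr m n (A : 'M[R]_(m, n)) x :
  differentiable (fun u : 'rV[R]_m => u *m A) x.
Proof.
apply: differentiable_row => j.
rewrite (_ : (fun _ => _) =
  \sum_(i < m) (fun u : 'rV[R]_m => (u ord0 i : R) *: (A i j : R))).
  apply: differentiable_sum => i; apply: differentiableZl.
  exact: differentiable_coord.
by apply/funext => u; rewrite mxE fct_sumE.
Qed.

Lemma diff_mulmxr m n (A : 'M[R]_(m, n)) x v :
  'd (fun u : 'rV[R]_m => u *m A) x v = v *m A.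
Proof.
rewrite (_ : (fun u : 'rV[R]_m => u *m A) = mulmxr A)// diff_lin// => y.
by apply: differentiable_continuous; exact: differentiable_mulmxr.
Qed.

Lemma diff_jacobian m n (f : 'rV[R]_m -> 'rV[R]_n) x v :
  'd f x v = v *m 'J f x.
Proof. by rewrite mul_rV_lin1. Qed.

Lemma jacobian_close d D (f g : 'rV[R]_d -> 'rV[R]_D) x c u : 0 <= c ->
  (forall v, enorm v = 1 -> `|'d f x v - 'd g x v| <= c) ->
  enorm (u *m 'J f x - u *m 'J g x) <= Num.sqrt D%:R * c * enorm u.
Proof.
move=> c0 fg; rewrite -mulmxBr; apply: enorm_mulmx_le => // v /fg.
congr (`|_| <= _); rewrite mulmxBr.
by congr (_ - _); apply: diff_jacobian.
Qed.

Lemma diff_grad n (f : 'rV[R]_n -> R) x v :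
  differentiable f x -> 'd f x v = dot (grad f x) v.
Proof.
move=> df; rewrite [v in LHS]row_sum_delta linear_sum; apply: eq_bigr => j _.
by rewrite linearZ mxE deriveE// mulrC.
Qed.

Lemma grad_comp m n (f : 'rV[R]_n -> R) (g : 'rV[R]_m -> 'rV[R]_n) x :
  differentiable g x -> differentiable f (g x) ->
  grad (f \o g) x = grad f (g x) *m ('J g x)^T.
Proof.
move=> dg df; apply/rowP => j.
rewrite mxE deriveE; last exact: differentiable_comp.
rewrite diff_comp//= diff_grad// diff_jacobian dotC dot_mulmxl dotC.
rewrite dot_mul trmx_delta -colE mxE.
by [].
Qed.

(** Differentiate at the origin the identity that says that [x] is the vector of
    frame coordinates of [f x]. *)
Lemma jacobian_section d D (f : 'rV[R]_d -> 'rV[R]_D) q (B : 'M[R]_(d, D)) :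
  differentiable f 0 ->
  (\forall x \near (0 : 'rV[R]_d), (f x - q) *m B^T = x) ->
  'J f 0 *m B^T = 1%:M.
Proof.
move=> df fB; apply/row_matrixP => i; rewrite !rowE mulmxA -diff_jacobian.
rewrite mulmx1; set v := delta_mx _ _.
have dm y : differentiable (fun u : 'rV[R]_D => u *m B^T) y.
  exact: differentiable_mulmxr.
pose h : 'rV[R]_d -> 'rV[R]_d := (fun u => u *m B^T) \o f.
have dh : differentiable h 0 by exact: (differentiable_comp df (dm _)).
have dhE : 'd h 0 v = 'd f 0 v *m B^T.
  by rewrite (diff_comp df (dm _)) /comp diff_mulmxr.
have hE : \forall x \near (0 : 'rV[R]_d), h x = (id + cst (q *m B^T)) x.
  apply: filterS fB => x fx.
  by rewrite [RHS]/GRing.add/= -{2}fx mulmxBl subrK.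
rewrite -dhE -(deriveE v dh) (near_eq_derive v hE).
rewrite deriveD; [|exact: derivable_id|exact: derivable_cst].
by rewrite derive_id derive_cst addr0.
Qed.

End Calculus.

(** * Polynomial maps *)

Section PolyFun.
Context {R : realType} {d : nat}.
Implicit Types (p : 'rV[R]_d -> R).

Lemma meval_differentiable (Q : mpoly d R) x :
  differentiable (fun y : 'rV[R]_d => meval (fun i => y ord0 i) Q) x.
Proof.
have dpow (i : 'I_d) k : differentiable (fun y : 'rV[R]_d => y ord0 i ^+ k) x.
  elim: k => [|k IH].
    by rewrite (_ : (fun _ => _) = cst 1)//; exact: differentiable_cst.
  rewrite (_ : (fun _ => _) =
    (fun y : 'rV[R]_d => y ord0 i) * (fun y : 'rV[R]_d => y ord0 i ^+ k)).
    by apply: differentiableM => //; exact: differentiable_coord.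
  by apply/funext => y; rewrite exprS.
have dmon a : differentiable
    (fun y : 'rV[R]_d => meval (fun i => y ord0 i) (mpolyX R a)) x.
  rewrite (_ : (fun _ => _) =
    (fun y : 'rV[R]_d => \prod_(i < d) y ord0 i ^+ a i)); last first.
    by apply/funext => y; rewrite mevalX.
  elim: (index_enum _) => [|i r IH].
    rewrite (_ : (fun _ => _) = cst 1); first exact: differentiable_cst.
    by apply/funext => y; rewrite big_nil.
  rewrite (_ : (fun _ => _) = (fun y : 'rV[R]_d => y ord0 i ^+ a i) *
    (fun y : 'rV[R]_d => \prod_(i <- r) y ord0 i ^+ a i)).
    exact: differentiableM.
  by apply/funext => y; rewrite big_cons.
elim/mpolyind: Q => [|c a Q _ _ IH].
  rewrite (_ : (fun _ => _) = cst 0); first exact: differentiable_cst.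
  by apply/funext => y; rewrite meval0.
rewrite (_ : (fun _ => _) =
  c *: (fun y : 'rV[R]_d => meval (fun i => y ord0 i) (mpolyX R a)) +
  (fun y : 'rV[R]_d => meval (fun i => y ord0 i) Q)).
  by apply: differentiableD => //; exact: differentiableZ.
by apply/funext => y; rewrite mevalD mevalZ.
Qed.

Lemma poly_map_differentiable k m (g : 'rV[R]_d -> 'rV[R]_m) x :
  poly_map k g -> differentiable g x.
Proof.
move=> gk; apply: differentiable_row => j; have [Q _ ->] := gk j.
exact: meval_differentiable.
Qed.

Lemma poly_fun_const k (c : R) : poly_fun k (fun _ : 'rV[R]_d => c).
Proof.
exists (mpolyC d c); last by apply/funext => x; rewrite mevalC.
move=> a; rewrite msuppC; case: ifP => // _; rewrite inE => /eqP ->.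
by rewrite mdeg0.
Qed.

Lemma poly_fun_coord k (j : 'I_d) :
  (0 < k)%N -> poly_fun k (fun x : 'rV[R]_d => x ord0 j).
Proof.
move=> k0; exists (mpolyX R (mnm1 j)); last first.
  by apply/funext => x; rewrite mevalXU.
by move=> a; rewrite msuppX inE => /eqP ->; rewrite mdeg1.
Qed.

Lemma poly_funD k p q :
  poly_fun k p -> poly_fun k q -> poly_fun k (fun x => p x + q x).
Proof.
move=> [P Pk ->] [Q Qk ->]; exists (P + Q).
  move=> a /msuppD_le; rewrite mem_cat => /orP[/Pk|/Qk]//.
by apply/funext => x; rewrite mevalD.
Qed.

Lemma poly_funZ k c p : poly_fun k p -> poly_fun k (fun x => c * p x).
Proof.
move=> [P Pk ->]; exists (c *: P); first by move=> a /msuppZ_le/Pk.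
by apply/funext => x; rewrite mevalZ.
Qed.

Lemma poly_fun_sum k n (p : 'I_n -> 'rV[R]_d -> R) :
  (forall i, poly_fun k (p i)) -> poly_fun k (fun x => \sum_i p i x).
Proof.
move=> pk; elim: n p pk => [|n IH] p pk.
  rewrite (_ : (fun _ => _) = (fun=> 0)); first exact: poly_fun_const.
  by apply/funext => x; rewrite big_ord0.
rewrite (_ : (fun _ => _) = (fun x => p ord0 x + \sum_i p (lift ord0 i) x)).
  by apply: poly_funD => //; apply: IH.
by apply/funext => x; rewrite big_ord_recl.
Qed.

Lemma poly_map_mulmx k m n (g : 'rV[R]_d -> 'rV[R]_m) (A : 'M[R]_(m, n)) :
  poly_map k g -> poly_map k (fun x => g x *m A).
Proof.
move=> gk j; rewrite (_ : (fun _ => _) = (fun x => \sum_i A i j * g x ord0 i)).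
  by apply: poly_fun_sum => i; exact: poly_funZ.
by apply/funext => x; rewrite mxE; apply: eq_bigr => i _; rewrite mulrC.
Qed.

Lemma poly_mapD k m (g g' : 'rV[R]_d -> 'rV[R]_m) :
  poly_map k g -> poly_map k g' -> poly_map k (fun x => g x + g' x).
Proof.
move=> gk gk' j.
rewrite (_ : (fun _ => _) = (fun x => g x ord0 j + g' x ord0 j)).
  exact: poly_funD.
by apply/funext => x; rewrite mxE.
Qed.

Lemma poly_map_const k m (c : 'rV[R]_m) : poly_map k (fun _ : 'rV[R]_d => c).
Proof. by move=> j; exact: poly_fun_const. Qed.

Lemma poly_map_id k : (0 < k)%N -> poly_map k (fun x : 'rV[R]_d => x).
Proof. by move=> k0 j; exact: poly_fun_coord. Qed.
End PolyFun.

(** * Tangent spaces from local parametrizations *)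

Section Tangent.
Context {R : realType} {d D : nat}.

(** The Euclidean norm and the sup norm are equivalent, so Euclidean balls are
    neighbourhoods. *)
Lemma near_enorm_lt n (y : 'rV[R]_n) (e : R) :
  0 < e -> \forall z \near y, enorm (z - y) < e.
Proof.
move=> e0; apply/nbhs_normP; exists (e / (Num.sqrt n%:R + 1)).
  by rewrite /= divr_gt0// ltr_wpDl ?sqrtr_ge0.
move=> z /=; rewrite ltr_pdivlMr ?ltr_wpDl ?sqrtr_ge0// distrC => zy.
rewrite (le_lt_trans (enorm_le_sup _))// (le_lt_trans _ zy)// mulrC.
by rewrite ler_wpM2l// lerDl.
Qed.

(** A curve in [A] through [ph 0] is [ph] of its coordinates, so its velocity is
    in the range of the Jacobian of [ph]; conversely [t |-> ph (t u)] has
    velocity [u *m 'J ph 0]. *)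
Lemma tangent_local_param r (A : set 'rV[R]_D) q y (B : 'M[R]_(d, D)) rho ph :
  0 < rho -> local_param r A q y B rho ph -> manifold_at r d A y ->
  tangent A y = row_space ('J ph 0).
Proof.
move=> rho0 [ph0 phA _ phd [e e0 phK]] my.
have rho0' : enorm (0 : 'rV[R]_d) < rho by rewrite enorm0.
have phB : (y - q) *m B^T = 0 by have [_] := phA 0 rho0'; rewrite ph0.
have dph : differentiable ph 0 by apply: phd; rewrite ?enorm0 ?ph0.
apply/seteqP; split=> v.
- case=> c [c0 cA cv].
  have dc : differentiable c 0 by apply/derivable1_diffP.
  pose l := (fun u : 'rV[R]_D => u *m B^T) \o c.
  have dm := differentiable_mulmxr B^T.
  have dl : differentiable l 0 by exact: (differentiable_comp dc (dm _)).
  have lE : 'D_1 l 0 = v *m B^T.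
    rewrite (deriveE _ dl) (diff_comp dc (dm _)) /comp diff_mulmxr.
    by rewrite -(deriveE _ dc) derive_val.
  pose k := l + cst (- (q *m B^T)).
  have kd : derivable k 0 1.
    by apply: derivableD; [exact: diff_derivable|exact: derivable_cst].
  have dk : differentiable k 0 by apply/derivable1_diffP.
  have kE : 'D_1 k 0 = v *m B^T.
    rewrite deriveD; [|exact: diff_derivable|exact: derivable_cst].
    by rewrite derive_cst addr0.
  have k_coord t : k t = (c t - q) *m B^T by rewrite mulmxBl.
  have k0 : k 0 = 0 by rewrite k_coord c0.
  have ck : \forall t \near (0 : R), c t = (ph \o k) t.
    have cy : \forall t \near (0 : R), enorm (c t - y) < e.
      rewrite -c0.
      exact: (differentiable_continuous dc (near_enorm_lt (c 0) e0)).
    by near=> t; rewrite /= k_coord phK//; near: t.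
  have dphk : differentiable ph (k 0) by rewrite k0.
  exists (v *m B^T) => //; rewrite -diff_jacobian -kE (deriveE _ dk).
  have -> : 'd ph 0 ('d k 0 1) = 'd (ph \o k) 0 1.
    by rewrite (diff_comp dk dphk) /= k0.
  rewrite -(deriveE _ (differentiable_comp dk dphk)).
  by rewrite -(near_eq_derive (1 : R) ck) derive_val.
- case=> u _ <-.
  have [ds dsE] := is_diff_scalel (0 : R) u.
  have s0 : (0 : R) *: u = 0 by rewrite scale0r.
  have dphs : differentiable ph ((0 : R) *: u) by rewrite s0.
  exists (ph \o ( *:%R ^~ u)); split; first by rewrite /= s0.
    have su : \forall t \near (0 : R), enorm (t *: u - 0 *: u) < rho.
      exact: (differentiable_continuous ds (near_enorm_lt _ rho0)).
    by apply: filterS su => t; rewrite scale0r subr0 => /phA[].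
  have dphsu : differentiable (ph \o ( *:%R ^~ u)) (0 : R).
    exact: differentiable_comp.
  apply: DeriveDef; first exact: diff_derivable.
  by rewrite deriveE// diff_comp//= dsE s0 scale1r diff_jacobian.
Unshelve. all: by end_near. Qed.

End Tangent.

(** * Exactness of the least squares fit along its plane *)

Section LeastSquaresFit.
Context {R : realType} {D d : nat}.
Implicit Types (P : setting R D d) (X : level R D d).

Lemma man_Uunique P X p : mmls_solutions P X -> man P p -> Uunique P X p.
Proof.
move=> [[e e0 eu] _ _ _] Mp; exists e; split => //.
rewrite /nbhd_of /= (le_lt_trans _ e0)//; apply: ge_inf.
  by exists 0 => _ [y _ <-]; exact: enorm_ge0.
by exists p => //; rewrite subrr enorm0.
Qed.

(** Replacing the component of g* along [H(r)] by the exact coordinates keeps it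
    a polynomial of the same degree and removes, at each site, the component
    along [H(r)] of the residual. It thus does not increase the cost; g* being
    the only minimizer, nothing changes. *)
Lemma gst_section P X r :
  setting_ok P -> level_ok P X -> Uunique P X r ->
  let B := frame P (Hsp X r) in
  B *m B^T = 1%:M /\ forall x, (gst X r x - qpt X r) *m B^T = x.
Proof.
move=> [_ [_ m1] _ frameP [_ [[Phi0 _ _ _ _] _] _ _ _]].
move=> [h0 _ _ [_ step1 step2 _] _] Ur B.
have [[/= dimH _ _ _] _] := step1 _ Ur.
have [BB _] := frameP _ dimH; rewrite -/B in BB; split=> // x.
have [[gk gmin] guniq] := step2 _ Ur.
set g := gst X r in gk gmin guniq *; set q := qpt X r.
pose g' y := g y + ((g y + - q) *m B^T + y *m (- 1%:M)) *m (- B).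
have g'E y : g' y = g y - ((g y - q) *m B^T - y) *m B.
  by rewrite /g' mulmxN mulmxN mulmx1.
have g'k : poly_map (deg P) g'.
  apply: poly_mapD => //; apply: poly_map_mulmx; apply: poly_mapD.
    by apply: poly_map_mulmx; apply: poly_mapD => //; exact: poly_map_const.
  by apply: poly_map_mulmx; exact: poly_map_id.
have wt0 s : 0 <= s -> (0 <= wt (Phi P) (fill X) s)%E.
  rewrite /wt; case: eqP => [_ _|/eqP s1 s0]; first exact: leey.
  by rewrite lee_fin Phi0// divr_gt0// lt_def s1.
have cost_le : (step2_cost P X r g' <= step2_cost P X r g)%E.
  apply: lee_sum => i _; apply: lee_wpmul2r; first by rewrite wt0 ?enorm_ge0.
  rewrite lee_fin ler_sqr ?nnegrE ?enorm_ge0// g'E /coordH -/B -/q.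
  set u := g _; set s := smp i.
  have -> : u - ((u - q) *m B^T - (s - q) *m B^T) *m B - s =
      (u - s) - (u - s) *m B^T *m B.
    by rewrite -mulmxBl opprB addrA subrK addrAC.
  set v := u - s; set w := v *m B^T *m B.
  have wv : dot w (v - w) = 0.
    rewrite dot_mulmxl [X in dot _ X]mulmxBl -[w *m _]mulmxA BB mulmx1 subrr.
    by rewrite dotC dot0l.
  apply: enorm_le_sqr; first exact: enorm_ge0.
  rewrite -[v in leRHS](subrK w) sqr_enorm (pythagoras (etrans (dotC _ _) wv)).
  by rewrite sqr_enorm lerDl sqr_ge0.
have /guniq g'g : is_min (poly_map (deg P)) (step2_cost P X r) g'.
  by split=> // y /gmin; exact: le_trans.
have := congr1 (fun k => k x) g'g; rewrite /= g'E.
move=> /eqP; rewrite addrC -subr_eq0 addrK oppr_eq0 => /eqP cB.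
have : ((g x - q) *m B^T - x) *m B *m B^T = 0 by rewrite cB mul0mx.
by rewrite -mulmxA BB mulmx1 => /eqP; rewrite subr_eq0 => /eqP.
Qed.

Lemma gst_differentiable P X r x :
  level_ok P X -> Uunique P X r -> differentiable (gst X r) x.
Proof.
move=> [_ _ _ [_ _ step2 _] _] /step2[[gk _] _].
exact: poly_map_differentiable gk.
Qed.

End LeastSquaresFit.

(** * Error of the approximate gradient *)

Section GradientError.
Context {R : realType} {D d : nat}.
Implicit Types (P : setting R D d) (X : level R D d).

(** The parametrizations of the manifold and of the approximating set are both
    sections of the same orthogonal projection, whence the same consequences for
    their differentials. *)
Lemma local_param_jacobian r (A : set 'rV[R]_D) q y (B : 'M[R]_(d, D)) rho ph :
  0 < rho -> B *m B^T = 1%:M -> local_param r A q y B rho ph ->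
  manifold_at r d A y ->
  [/\ differentiable ph 0, expanding ('J ph 0)
    & tangent A y = row_space ('J ph 0)].
Proof.
move=> rho0 BB lp my; have [ph0 phA _ phd _] := lp.
have dph : differentiable ph 0 by apply: phd; rewrite ?enorm0 ?ph0.
split=> //; last exact: tangent_local_param lp my.
apply: (section_expanding BB); apply: (@jacobian_section _ _ _ _ q) => //.
apply: filterS (near_enorm_lt 0 rho0) => x.
by rewrite subr0 => /phA[].
Qed.

Lemma gst_jacobian P X p : setting_ok P -> level_ok P X -> man P p ->
  let B := frame P (Hsp X p) in
  [/\ B *m B^T = 1%:M, Jg X (mmls X p) = 'J (gst X p) 0
    & expanding (Jg X (mmls X p))].
Proof.
move=> HP HX Mp B; have [_ _ _ sol [[_ _ _ _ fix_] _]] := HX.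
have [_ _ gE _] := fix_ _ Mp; have Up := man_Uunique sol Mp.
have [BB gB] := gst_section HP HX Up.
have JgE : Jg X (mmls X p) = 'J (gst X p) 0 by rewrite /Jg gE.
split; [exact: BB|exact: JgE|rewrite JgE].
apply: (section_expanding BB).
apply: (@jacobian_section _ _ _ _ (qpt X p)).
  exact: gst_differentiable HX Up.
by near=> x; exact: gB.
Unshelve. all: by end_near. Qed.

(** The errors of the fit of the manifold and of the fit of the function, from
    coordinatewise bounds to Euclidean ones; for the second, the gradient of the
    function in coordinates is the ambient one composed with [Jphi]. *)
Lemma gst_phi_close P X p : setting_ok P -> level_ok P X -> man P p ->
  let J := Jg X (mmls X p) in
  let Jphi := 'J (phi X p) 0 in
  let c := Num.sqrt D%:R * fill X ^+ deg P in
  [/\ expanding Jphi, tangent (man P) p = row_space Jphi,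
      forall u, enorm (u *m J - u *m Jphi) <= cM P * c * enorm u
    & enorm (grad (pfn X (mmls X p)) 0 - grad (fn P) p *m Jphi^T)
        <= cf P * c].
Proof.
move=> HP HX Mp J Jphi c; have [BB JE eJ] := gst_jacobian HP HX Mp.
have [[_ manP] _ fP _ [[_ c1P _ _] _ _ [_ cM0 _ cf0 _] _]] := HP.
have [h0 _ _ _ [_ cst_]] := HX; have [lp _ _ [gM _] gf] := cst_ _ Mp.
have hm0 : 0 <= fill X ^+ deg P by rewrite exprn_ge0 ?ltW.
have c10 : 0 < c1 P by apply: lt_trans c1P; rewrite ltr0n.
have rho0 := mulr_gt0 c10 h0.
have [dphi ephi tphi] := local_param_jacobian rho0 BB lp (manP _ Mp).
split; [exact: ephi|exact: tphi| |].
- move=> u; rewrite /J JE /c mulrCA; apply: jacobian_close.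
    exact: mulr_ge0.
  by move=> v; apply: gM; rewrite enorm0.
- have phi0 : phi X p 0 = p by case: lp.
  have df : differentiable (fn P) (phi X p 0).
    by have [dfP _] := fP 1%N isT; exact: dfP.
  have := gf 0; rewrite enorm0 => /(_ rho0).
  rewrite (grad_comp dphi df) phi0 => gf0.
  have dD : (d <= D)%N by apply: mulmx1_min BB.
  apply: (le_trans (enorm_le_sup _)); rewrite /c mulrCA.
  apply: ler_pM; [exact: sqrtr_ge0|exact: normr_ge0| |exact: gf0].
  by apply: ler_wsqrtr; rewrite ler_nat.
Qed.

(** Both vectors are images under the pseudo-inverse: of the fitted partial
    derivatives, and of the derivatives of [fn P] along the columns of Dg*. The
    latter differ from the derivatives along the manifold by the first order
    error of g*. *)
Lemma agrad_proj_close P X p : setting_ok P -> level_ok P X -> man P p ->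
  enorm (agrad X (mmls X p)
         - orth_proj (row_space (Jg X (mmls X p))) (grad (fn P) p))
    <= (cf P + cM P * enorm (grad (fn P) p))
       * (Num.sqrt D%:R * fill X ^+ deg P).
Proof.
move=> HP HX Mp; set r := mmls X p; set a := grad (fn P) p; set c := _ * _ ^+ _.
have [_ _ eJ] := gst_jacobian HP HX Mp.
have [_ _ Jclose bclose] := gst_phi_close HP HX Mp.
rewrite -/r -/a -/c in eJ Jclose bclose *.
have c0 : 0 <= c.
  by case: HX => h0 *; rewrite mulr_ge0 ?sqrtr_ge0 ?exprn_ge0 ?ltW.
have cM0 : 0 <= cM P by case: HP => _ _ _ _ [_ _ _ [_ + _ _ _] _].
have cMc0 : 0 <= cM P * c by exact: mulr_ge0.
rewrite orth_proj_row_space// -[agrad X r]/(pinv (Jg X r) (grad (pfn X r) 0)).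
rewrite pinvB (le_trans (pinv_le _ eJ))//.
set b := grad (pfn X r) 0 in bclose *.
set J := Jg X r in Jclose *; set Jphi := jacobian _ _ in bclose Jclose.
rewrite -(subrKA (a *m Jphi^T)) (le_trans (enormD _ _))// mulrDl.
rewrite lerD// enormBC mulrAC.
exact: trmx_close.
Qed.

(** The second [cM P] comes from the angle between the range of Dg* and the
    tangent space, the first from [agrad_proj_close]. *)
Lemma rgrad_man_le P X p : setting_ok P -> level_ok P X -> man P p ->
  enorm (rgrad (man P) (fn P) p) <=
    enorm (agrad X (mmls X p)) +
    (cf P + 2 * cM P * enorm (grad (fn P) p))
      * (Num.sqrt D%:R * fill X ^+ deg P).
Proof.
move=> HP HX Mp; have [_ _ eJ] := gst_jacobian HP HX Mp.
have [ephi tphi Jclose _] := gst_phi_close HP HX Mp.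
have := agrad_proj_close HP HX Mp; rewrite /rgrad tphi.
have c0 : 0 <= Num.sqrt D%:R * fill X ^+ deg P.
  by case: HX => h0 *; rewrite mulr_ge0 ?sqrtr_ge0 ?exprn_ge0 ?ltW.
have cM0 : 0 <= cM P by case: HP => _ _ _ _ [_ _ _ [_ + _ _ _] _].
move: (agrad _ _) (jacobian _ _) (Jg _ _) (_ * _ ^+ _) (grad _ _)
  => g Jphi J c a in eJ ephi Jclose c0 *.
move=> close; have gap := orth_proj_gap a (mulr_ge0 cM0 c0) eJ ephi Jclose.
set pJ := orth_proj (row_space J) a in close gap.
set pphi := orth_proj _ a in gap *.
have -> : pphi = g - (g - pJ) - (pJ - pphi).
  by rewrite subKr opprB addrC subrK.
rewrite (le_trans (enormD _ _))// enormN.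
rewrite (le_trans (lerD (enormD _ _) (lexx _)))// enormN.
lra.
Qed.

(** The projection moves [p] by O(h^(m+1)); one factor h is spent on
    [fill X * Lip P <= 1]. *)
Lemma grad_mmls_le P X p : level_ok P X ->
  grad_lipschitz_on (conv_hull (Mtil P X `|` man P)) (Lip P) (fn P) ->
  man P p -> enorm (grad (fn P) (mmls X p) - grad (fn P) p)
    <= cMMLS P * (Num.sqrt D%:R * fill X ^+ deg P).
Proof.
move=> HX HL Mp; have [h0 _ _ _ [[hL _ _ _ _] cst_]] := HX.
have [_ _ close _ _] := cst_ _ Mp.
have sub := @sub_gen_smallest _ (@convex_set R 'rV[R]_D) (Mtil P X `|` man P).
have Hp : conv_hull (Mtil P X `|` man P) p by apply: sub; right.
have Hr : conv_hull (Mtil P X `|` man P) (mmls X p).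
  by apply: sub; left; exists p.
apply: (le_trans (HL _ _ Hp Hr)).
set e := enorm _ in close *; have e0 : 0 <= e by exact: enorm_ge0.
have rhs0 : 0 <= cMMLS P * (Num.sqrt D%:R * fill X ^+ deg P).
  have : 0 <= cMMLS P * Num.sqrt D%:R * fill X ^+ (deg P).+1.
    exact: le_trans close.
  by rewrite exprSr mulrA pmulr_lge0// -mulrA.
(* Multiplying the bound on the displacement by [Lip P] preserves it only for
   a nonnegative constant; otherwise the gradients coincide. *)
have [L0|L0] := leP (Lip P) 0.
  by apply: le_trans rhs0; exact: mulr_le0_ge0.
apply: (le_trans (ler_wpM2l (ltW L0) close)).
have -> : Lip P * (cMMLS P * Num.sqrt D%:R * fill X ^+ (deg P).+1)
    = (fill X * Lip P) * (cMMLS P * (Num.sqrt D%:R * fill X ^+ deg P)).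
  by rewrite exprS; ring.
by rewrite -[leRHS]mul1r ler_wpM2r.
Qed.

(** The three sources of error: the gradient is taken at [mmls X p] instead of
    [p], the tangent space is replaced by the range of Dg*, and the projection
    on it is computed from approximate data. *)
Lemma rgrad_Mtil_close P X p : setting_ok P -> level_ok P X ->
  grad_lipschitz_on (conv_hull (Mtil P X `|` man P)) (Lip P) (fn P) ->
  man P p -> manifold_at None d (Mtil P X) (mmls X p) ->
  enorm (rgrad (Mtil P X) (fn P) (mmls X p) - agrad X (mmls X p))
    <= Eerr P X p.
Proof.
move=> HP HX HL Mp Mr.
have [BB JE eJ] := gst_jacobian HP HX Mp.
have [h0 _ _ _ [_ cst_]] := HX; have [_ lp _ [_ gMt] _] := cst_ _ Mp.
have [[_ _] _ _ _ [[_ c1P _ _] _ _ [_ cM0 cMt0 _ _] _]] := HP.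
have hm0 : 0 <= fill X ^+ deg P by rewrite exprn_ge0 ?ltW.
have c0 : 0 <= Num.sqrt D%:R * fill X ^+ deg P by rewrite mulr_ge0 ?sqrtr_ge0.
have c10 : 0 < c1 P by apply: lt_trans c1P; rewrite ltr0n.
have rho0 := mulr_gt0 c10 h0.
have [dphit ephit tphit] := local_param_jacobian rho0 BB lp Mr.
have Jclose u : enorm (u *m Jg X (mmls X p) - u *m 'J (phit X p) 0)
    <= cMt P * (Num.sqrt D%:R * fill X ^+ deg P) * enorm u.
  rewrite JE mulrCA; apply: jacobian_close; first exact: mulr_ge0.
  move=> v v1; apply: (gMt 0 v _ v1); first by rewrite enorm0.
  by case: lp => -> *.
have close := agrad_proj_close HP HX Mp.
have dgrad := grad_mmls_le HX HL Mp.
rewrite /rgrad tphit /Eerr.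
rewrite -[_ * Num.sqrt _ * _]mulrA.
move: (agrad _ _) (jacobian _ _) (Jg _ _) (_ * _ ^+ _) (grad (fn P) p)
    (grad (fn P) (mmls X p))
  => g Jt J c a ar in eJ ephit Jclose c0 close dgrad *.
have gap := orth_proj_gap a (mulr_ge0 cMt0 c0) eJ ephit Jclose.
have contr := le_trans (orth_proj_row_space_le ar a ephit) dgrad.
set pJ := orth_proj (row_space J) a in close gap.
set pa := orth_proj (row_space Jt) a in gap contr.
set par := orth_proj _ ar in contr *.
have -> : par - g = (par - pa) - ((g - pJ) + (pJ - pa)).
  by rewrite addrA subrK !opprB addrA subrK.
apply: (le_trans (enormD _ _)); rewrite enormN.
apply: (le_trans (lerD (lexx _) (enormD _ _))).
have := mulr_ge0 (mulr_ge0 cM0 (enorm_ge0 a)) c0.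
lra.
Qed.

End GradientError.

(** * Decrease of the cost in one step *)

Section Descent.
Context {R : realType}.
Implicit Types (N Q Lt Lv err : R).

(** The first term is what a step of length [Q] gains, the second what a step of
    length of order [N / Lt] gains. *)
Definition min_decrease Q Lt N := Num.min (Q * N / 16) (N ^+ 2 / (32 * Lt)).

Lemma min_decrease_le Q Lt t N : 0 <= Q -> 0 < Lt -> 0 <= t -> t <= N ->
  min_decrease Q Lt t <= min_decrease Q Lt N.
Proof.
move=> Q0 Lt0 t0 tN; rewrite /min_decrease le_min !ge_min.
apply/andP; split; apply/orP; [left|right].
  by rewrite ler_pM2r// ler_wpM2l.
by rewrite ler_pM2r ?invr_gt0 ?mulr_gt0// ler_sqr ?nnegrE// (le_trans t0).
Qed.

Lemma min_decrease_gt0 Q Lt N :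
  0 < Q -> 0 < Lt -> 0 < N -> 0 < min_decrease Q Lt N.
Proof.
by move=> Q0 Lt0 N0; rewrite lt_min !divr_gt0 ?mulr_gt0 ?exprn_gt0.
Qed.

(** The two bounds agree at [N = 2 * Q * Lt], so that the threshold decides
    which one is the minimum. *)
Lemma min_decreasel Q Lt N : 0 < Lt -> 0 <= N -> 2 * Q * Lt <= N ->
  min_decrease Q Lt N = Q * N / 16.
Proof.
move=> Lt0 N0 QN; apply: min_l.
rewrite ler_pdivlMr ?mulr_gt0//.
have := ler_wpM2r N0 QN; rewrite expr2; lra.
Qed.

Lemma min_decreaser Q Lt N : 0 < Lt -> 0 <= N -> N <= 2 * Q * Lt ->
  min_decrease Q Lt N = N ^+ 2 / (32 * Lt).
Proof.
move=> Lt0 N0 QN; apply: min_r.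
rewrite ler_pdivrMr ?mulr_gt0//.
have := ler_wpM2r N0 QN; rewrite expr2; lra.
Qed.

(** If the step length is limited by [Q], the decrease is of first order in
    [N]; otherwise the step length is the optimal one and the decrease is
    quadratic. In both cases the assumptions on [Lv] let the error term
    [(N + err) * Lv] eat at most three quarters of the decrease. *)
Lemma quadratic_model_decrease Q Lt Lv err N a : 0 < N -> 0 < Q -> 0 < Lt ->
  0 < Lv -> 8 * Lv <= Q -> 16 * Lt * Lv <= N -> 2 * err <= N ->
  a = Num.min (Q / N) (Lt^-1 * (1 - err / N)) ->
  min_decrease Q Lt N
    <= a * (N ^+ 2 - err * N) - (N + err) * Lv - Lt / 2 * (a * N) ^+ 2.
Proof.
move=> N0 Q0 Lt0 Lv0 LvQ LvN errN aE.
(* [M * N] bounds from below the inner product of the exact and the approximate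
   gradients. *)
pose M := N - err; have MN : N / 2 <= M by rewrite /M; lra.
have errLv : (N + err) * Lv <= 3 / 2 * N * Lv.
  by rewrite ler_pM2r//; lra.
have aN : a * N = Num.min Q (M / Lt).
  rewrite aE minr_pMl ?(ltW N0)// divfK ?gt_eqF//; congr Num.min.
  by rewrite /M; field; rewrite !gt_eqF.
have -> : a * (N ^+ 2 - err * N) = (a * N) * M by rewrite /M; ring.
rewrite aN /min_decrease; case: (leP Q (M / Lt)) => [QM|QM].
  rewrite ler_pdivlMr// in QM; rewrite ge_min; apply/orP; left.
  have h1 := ler_wpM2l (ltW Q0) QM.
  have h2 := ler_wpM2l (ltW Q0) MN.
  have h3 := ler_wpM2l (ltW N0) LvQ.
  rewrite expr2; lra.
rewrite ge_min; apply/orP; right.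
have -> : M / Lt * M - (N + err) * Lv - Lt / 2 * (M / Lt) ^+ 2
    = (M ^+ 2 / 2 - (N + err) * Lv * Lt) / Lt.
  by field; rewrite gt_eqF.
rewrite invfM mulrA ler_pM2r ?invr_gt0//.
have h1 : (N / 2) ^+ 2 <= M ^+ 2 by rewrite ler_sqr ?nnegrE; lra.
have h2 := ler_wpM2r (ltW Lt0) errLv.
have h3 := ler_wpM2l (ltW N0) LvN.
rewrite expr2 in h1; rewrite [N ^+ 2]expr2; lra.
Qed.

End Descent.

Section Step.
Context {R : realType} {D d : nat}.
Implicit Types (P : setting R D d) (X : level R D d).

(** [Qrad X] is the infimum of radii for which the statement holds point by
    point. *)
Lemma step_Mtil P X r xi : level_ok P X -> retraction_domain P X ->
  Mtil P X r -> atangent X r xi -> enorm xi <= Qrad X ->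
  Mtil P X (aretr X r xi).
Proof.
move=> HX [Q0 [Qr [QE Qrp]]] Mr txi xiQ.
have [_ _ _ _ [[_ _ _ sub _] _]] := HX.
apply: sub; exists (r + xi) => //.
have [_] := Qrp _ Mr; apply=> //; apply: (le_trans xiQ).
rewrite QE; apply: ge_inf; last by exists r.
by exists 0 => _ [s Ms <-]; rewrite ltW//; case: (Qrp _ Ms).
Qed.

(** The expansion of the cost along the approximate retraction, in which the
    Riemannian gradient differs from the approximate one by at most [Eerr],
    reduces the decrease to the one of [quadratic_model_decrease]. *)
Lemma step_decrease P X p : setting_ok P -> level_ok P X ->
  grad_lipschitz_on (conv_hull (Mtil P X `|` man P)) (Lip P) (fn P) ->
  retraction_domain P X -> retraction_expansion P X ->
  8 * Lv X <= Qrad X -> man P p -> manifold_at None d (Mtil P X) (mmls X p) ->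
  floor_term P X p <= enorm (agrad X (mmls X p)) ->
  0 < alpha (Qrad X) (Ltil P) (Eerr P X p) (agrad X (mmls X p)) ->
  let r := mmls X p in
  let g := agrad X r in
  let y := aretr X r (alpha (Qrad X) (Ltil P) (Eerr P X p) g *: - g) in
  Mtil P X y /\
  min_decrease (Qrad X) (Ltil P) (enorm g) <= fn P r - fn P y.
Proof.
move=> HP HX HL HQ [Lv0 HK] HQL Mp Mr fl a0 r g y.
have Lt0 : 0 < Ltil P by case: HP => _ _ _ _ [_ _ _ [_ _ _ _ ?] _].
have Q0 : 0 < Qrad X by case: HQ.
move: fl; rewrite /floor_term ge_max -/r -/g => /andP[flLv flE].
have N0 : 0 < enorm g.
  by apply: lt_le_trans flLv; rewrite !mulr_gt0.
have errN := rgrad_Mtil_close HP HX HL Mp Mr; rewrite -/r -/g in errN.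
set a := alpha _ _ _ _ in a0 y *; set xi := a *: - g in y *.
have tr : Mtil P X r by exists p.
have txi : atangent X r xi.
  exists (a *: - (grad (pfn X r) 0 *m invmx (Jg X r *m (Jg X r)^T))) => //.
  by rewrite -scalemxAl mulNmx.
have xiE : enorm xi = a * enorm g by rewrite enormZ enormN gtr0_norm.
have xiQ : enorm xi <= Qrad X.
  by rewrite xiE -ler_pdivlMr// /a /alpha ge_min lexx.
split; first exact: step_Mtil HX HQ tr txi xiQ.
have [_ _ _ vLv expan] := HK r xi (And3 tr txi xiQ) Mr.
set G := rgrad _ _ _ in expan errN; set v := derive1 _ _ in vLv expan.
have Gg : enorm g ^+ 2 - Eerr P X p * enorm g <= dot G g.
  rewrite -[G](subrK g) dotDl -sqr_enorm.
  have := dot_le (g - G) g; rewrite enormBC => h1.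
  have h2 := ler_wpM2r (ltW N0) errN.
  by rewrite -[G - g]opprB dotNl; lra.
have GE : enorm G <= enorm g + Eerr P X p.
  rewrite -[G](subrK g); apply: (le_trans (enormD _ _)).
  by rewrite addrC lerD2l.
have Gv : - ((enorm g + Eerr P X p) * Lv X) <= - dot G v.
  rewrite lerN2; apply: (le_trans (dot_le _ _)).
  by apply: ler_pM => //; exact: enorm_ge0.
have {}Gg := ler_wpM2l (ltW a0) Gg.
have dec := quadratic_model_decrease N0 Q0 Lt0 Lv0 HQL flLv flE (erefl a).
apply: (le_trans dec).
move: expan; rewrite ler_norml => /andP[_].
rewrite dotDr /xi dotZr dotNr xiE -/xi.
lra.
Qed.
End Step.

(** * Number of iterations *)

Section Iterations.
Context {R : realType} {D d : nat}.
Implicit Types (P : setting R D d) (X : level R D d).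

Lemma iterates_decrease P X eps (x p : nat -> 'rV[R]_D) k :
  setting_ok P -> level_ok P X ->
  grad_lipschitz_on (conv_hull (Mtil P X `|` man P)) (Lip P) (fn P) ->
  retraction_domain P X -> retraction_expansion P X -> 8 * Lv X <= Qrad X ->
  Mtil P X (x 0%N) ->
  (forall j, Mtil P X (x j) -> man P (p j) /\ mmls X (p j) = x j) ->
  (forall j, (forall l, (l <= j)%N -> ~ gradient_reached P X eps (x l) (p l)) ->
     performed P X x p j) ->
  (forall l, (l < k)%N -> ~ gradient_reached P X eps (x l) (p l)) ->
  Mtil P X (x k) /\
  forall t, 0 <= t -> (forall l, (l < k)%N -> t <= enorm (agrad X (x l))) ->
    k%:R * min_decrease (Qrad X) (Ltil P) t <= fn P (x 0%N) - fn P (x k).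
Proof.
move=> HP HX HL HQ HK HQL x0 xp perf.
have Lt0 : 0 < Ltil P by case: HP => _ _ _ _ [_ _ _ [_ _ _ _ ?] _].
have Q0 : 0 < Qrad X by case: HQ.
elim: k => [|k IH] nreached.
  by split=> // t t0 _; rewrite mul0r subrr.
have [Mk dec] := IH (fun l lk => nreached l (ltnW lk)).
have [man_k mmls_k] := xp _ Mk.
have [mfd _ a0 fl xS] := perf k nreached.
rewrite -mmls_k in mfd a0 fl xS.
have [MS decS] := step_decrease HP HX HL HQ HK HQL man_k mfd fl a0.
rewrite -xS mmls_k in MS decS; split=> // t t0 tN.
have dec_k := dec t t0 (fun l lk => tN l (ltnW lk)).
have dec_t := min_decrease_le (ltW Q0) Lt0 t0 (tN k (ltnSn k)).
by rewrite mulrSr mulrDl mul1r; lra.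
Qed.

Lemma eps5_gt P X eps p : setting_ok P -> retraction_expansion P X ->
  eps < eps5 P X eps p.
Proof.
move=> HP [Lv0 _].
have Lt0 : 0 < Ltil P by case: HP => _ _ _ _ [_ _ _ [_ _ _ _ ?] _].
rewrite /eps5 ltrDr /floor_term lt_max; apply/orP; left.
by rewrite !mulr_gt0.
Qed.

(** A uniform decrease while the tolerance is not reached would make the cost
    unbounded below. *)
Lemma tolerance_reached P X eps (x p : nat -> 'rV[R]_D) :
  setting_ok P -> level_ok P X ->
  grad_lipschitz_on (conv_hull (Mtil P X `|` man P)) (Lip P) (fn P) ->
  retraction_domain P X -> retraction_expansion P X -> 8 * Lv X <= Qrad X ->
  (forall y, (man P `|` Mtil P X) y -> fstar X <= fn P y) -> 0 < eps ->
  Mtil P X (x 0%N) ->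
  (forall j, Mtil P X (x j) -> man P (p j) /\ mmls X (p j) = x j) ->
  (forall j, (forall l, (l <= j)%N -> ~ gradient_reached P X eps (x l) (p l)) ->
     performed P X x p j) ->
  exists2 k, gradient_reached P X eps (x k) (p k) &
    forall l, (l < k)%N -> ~ gradient_reached P X eps (x l) (p l).
Proof.
move=> HP HX HL HQ HK HQL low eps0 x0 xp perf.
have Lt0 : 0 < Ltil P by case: HP => _ _ _ _ [_ _ _ [_ _ _ _ ?] _].
have Q0 : 0 < Qrad X by case: HQ.
have [[k rk]|nr] := pselect (exists k, gradient_reached P X eps (x k) (p k)).
  have ex : exists k, `[< gradient_reached P X eps (x k) (p k) >].
    by exists k; apply/asboolP.
  exists (ex_minn ex); first by case: ex_minnP => m /asboolP.
  case: ex_minnP => m _ min l lm rl.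
  by have := min l (introT (asboolP _) rl); rewrite leqNgt lm.
have {}nr l : ~ gradient_reached P X eps (x l) (p l).
  by move: nr => /forallNP /(_ l).
have m0 := min_decrease_gt0 Q0 Lt0 eps0.
set m := min_decrease _ _ _ in m0.
have [k] : exists k : nat, (fn P (x 0%N) - fstar X) / m < k%:R.
  by eexists; apply: (le_lt_trans (ler_norm _) (archi_boundP (normr_ge0 _))).
rewrite ltr_pdivrMr// => km.
have [Mk dec] := iterates_decrease HP HX HL HQ HK HQL x0 xp perf
  (fun l (_ : (l < k)%N) => nr l).
have := dec eps (ltW eps0); rewrite -/m.
have eps_le l : (l < k)%N -> eps <= enorm (agrad X (x l)).
  move=> _; have := nr l; rewrite /gradient_reached => /negP; rewrite -ltNge.
  by move=> /ltW; apply: le_trans; rewrite ltW// eps5_gt.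
move=> /(_ eps_le); have := low (x k) (or_intror Mk); lra.
Qed.

(** The bounds are for the tolerance [e] of the last point, whereas the previous
    iterations were performed with their own ones; so the count stops at the
    first iterate whose gradient is at most [e]. *)
Lemma iteration_count P X eps (x p : nat -> 'rV[R]_D) k e :
  setting_ok P -> level_ok P X ->
  grad_lipschitz_on (conv_hull (Mtil P X `|` man P)) (Lip P) (fn P) ->
  retraction_domain P X -> retraction_expansion P X -> 8 * Lv X <= Qrad X ->
  (forall y, (man P `|` Mtil P X) y -> fstar X <= fn P y) ->
  Mtil P X (x 0%N) ->
  (forall j, Mtil P X (x j) -> man P (p j) /\ mmls X (p j) = x j) ->
  (forall j, (forall l, (l <= j)%N -> ~ gradient_reached P X eps (x l) (p l)) ->
     performed P X x p j) ->
  (forall l, (l < k)%N -> ~ gradient_reached P X eps (x l) (p l)) ->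
  0 < e -> enorm (agrad X (x k)) <= e ->
  exists2 j, (j <= k)%N &
    [/\ Mtil P X (x j), fn P (x j) <= fn P (x 0%N),
        enorm (agrad X (x j)) <= e
      & j%:R * min_decrease (Qrad X) (Ltil P) e <= fn P (x 0%N) - fstar X].
Proof.
move=> HP HX HL HQ HK HQL low x0 xp perf nr e0 ke.
have Lt0 : 0 < Ltil P by case: HP => _ _ _ _ [_ _ _ [_ _ _ _ ?] _].
have Q0 : 0 < Qrad X by case: HQ.
have ex : exists j, enorm (agrad X (x j)) <= e by exists k.
case: (ex_minnP ex) => j je jmin; have jk := jmin k ke.
have [Mj dec] := iterates_decrease HP HX HL HQ HK HQL x0 xp perf
  (fun l (lj : (l < j)%N) => nr l (leq_trans lj jk)).
have e_le l : (l < j)%N -> e <= enorm (agrad X (x l)).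
  move=> lj; rewrite ltW// ltNge; apply: contraTN lj => /jmin.
  by rewrite -leqNgt.
have {dec e_le} dec := dec e (ltW e0) e_le.
exists j => //; split=> //.
  rewrite -subr_ge0; apply: le_trans dec.
  exact: mulr_ge0 (ler0n R j) (ltW (min_decrease_gt0 Q0 Lt0 e0)).
apply: (le_trans dec); rewrite lerD2l lerN2; exact: low (or_intror Mj).
Qed.

Lemma rgrad_man_le_bound P X p e : setting_ok P -> level_ok P X -> man P p ->
  enorm (agrad X (mmls X p)) <= e ->
  enorm (rgrad (man P) (fn P) p) <= grad_bound P X e.
Proof.
move=> HP HX Mp ge; apply: (le_trans (rgrad_man_le HP HX Mp)).
have [h0 _ _ _ _] := HX.
have [_ _ _ _ [_ _ _ [_ cM0 _ _ _] G]] := HP.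
have c0 : 0 <= Num.sqrt D%:R * fill X ^+ deg P.
  by rewrite mulr_ge0 ?sqrtr_ge0 ?exprn_ge0 ?ltW.
rewrite /grad_bound -[_ * _ * fill X ^+ _]mulrA addrC.
apply: lerD => //; apply: ler_wpM2r => //.
by rewrite lerD2l; apply: ler_wpM2l; [rewrite mulr_ge0|exact: G].
Qed.

End Iterations.

(** * Limits, and the theorem *)

Section Limits.
Context {R : realType} {D d : nat}.
Context {I : Type} {F : set_system I} {FF : ProperFilter F}.
Implicit Types (P : setting R D d) (X : I -> level R D d).

Lemma cvg0_fill_pow P X (c : R) : setting_ok P ->
  fill (X i) @[i --> F] --> (0 : R) ->
  c * fill (X i) ^+ deg P @[i --> F] --> (0 : R).
Proof.
move=> [_ [_ m1] _ _ _] h0.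
have hm : fill (X i) ^+ deg P @[i --> F] --> (0 : R) ^+ deg P.
  apply: (@cvg_comp _ _ _ _ (fun t : R => t ^+ deg P) F _ _ h0).
  exact: exprn_continuous.
rewrite expr0n gtn_eqF// in hm.
by have := cvgM (cvg_cst c) hm; rewrite mulr0; apply.
Qed.

Lemma cvg0_floor_term P X (p : I -> 'rV[R]_D) : setting_ok P ->
  (forall i, level_ok P (X i)) -> (forall i, 0 < Lv (X i)) ->
  (forall i, man P (p i)) -> fill (X i) @[i --> F] --> (0 : R) ->
  Lv (X i) @[i --> F] --> (0 : R) ->
  floor_term P (X i) (p i) @[i --> F] --> (0 : R).
Proof.
move=> HP HX Lv0 Mp h0 Lvc.
have [_ _ _ _ [_ _ _ [cMMLS0 cM0 cMt0 cf0 Lt0] G]] := HP.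
pose C := 2 * ((2 * cM P * Gbd P + cMt P * Gbd P + cf P + cMMLS P)
  * Num.sqrt (D%:R : R)).
have up : 16 * Ltil P * Lv (X i) + C * fill (X i) ^+ deg P @[i --> F]
    --> (0 : R).
  have := cvgD (cvgM (cvg_cst (16 * Ltil P)) Lvc) (cvg0_fill_pow C HP h0).
  by rewrite mulr0 addr0; apply.
apply: (squeeze_cvgr _ (cvg_cst 0) up); apply: nearW => i.
have hm0 : 0 <= fill (X i) ^+ deg P.
  by have [hi _ _ _ _] := HX i; rewrite exprn_ge0 ?ltW.
have L0 : 0 <= 16 * Ltil P * Lv (X i) by rewrite ltW// !mulr_gt0.
have E0 : 0 <= Eerr P (X i) (p i).
  by rewrite /Eerr !mulr_ge0 ?sqrtr_ge0// !addr_ge0 ?mulr_ge0 ?enorm_ge0.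
have EC : 2 * Eerr P (X i) (p i) <= C * fill (X i) ^+ deg P.
  rewrite /C /Eerr -[leRHS]mulrA ler_wpM2l// ler_wpM2r// ler_wpM2r ?sqrtr_ge0//.
  by rewrite !lerD2r lerD// ler_wpM2l ?G// mulr_ge0.
rewrite /floor_term le_max L0 /= ge_max.
apply/andP; split; first by rewrite lerDl (le_trans _ EC)// mulr_ge0.
by rewrite (le_trans EC)// lerDr.
Qed.

End Limits.

Unset Implicit Arguments.

Theorem theorem28 (R : realType) (D d : nat) (P : setting R D d)
    (I : Type) (F : set_system I) (FF : ProperFilter F) (X : I -> level R D d)
    (HP : setting_ok P)
    (HX : forall i, level_ok P (X i))
    (HL : forall i,
      grad_lipschitz_on (conv_hull (Mtil P (X i) `|` man P)) (Lip P) (fn P))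
    (Hlow : forall i x, (man P `|` Mtil P (X i)) x -> fstar (X i) <= fn P x)
    (HQ : forall i, retraction_domain P (X i))
    (HK : forall i, retraction_expansion P (X i))
    (HLv : (fill (X i) @[i --> F] --> (0 : R)) ->
           (Lv (X i) @[i --> F] --> (0 : R)))
    (HQL : forall i, 8 * Lv (X i) <= Qrad (X i))
    (eps : R) (Heps : 0 < eps) :
  (forall (i : I) (x p : nat -> 'rV[R]_D),
    let f := fn P in
    let h := fill (X i) in
    let m := deg P in
    let Q := Qrad (X i) in
    let Lt := Ltil P in
    Mtil P (X i) (x 0%N) ->
    (forall j, Mtil P (X i) (x j) -> man P (p j) /\ mmls (X i) (p j) = x j) ->
    (forall j,
      (forall l, (l <= j)%N -> ~ gradient_reached P (X i) eps (x l) (p l)) ->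
      performed P (X i) x p j) ->
    exists k : nat,
      let e := eps5 P (X i) eps (p k) in
      let attained_within (B : int) :=
        exists2 j : nat, (j <= k)%N && (j%:Z <= B) &
          [/\ Mtil P (X i) (x j), f (x j) <= f (x 0%N),
              enorm (agrad (X i) (x j)) <= e
            & enorm (rgrad (man P) f (p j)) <= grad_bound P (X i) e] in
      [/\ (forall l, (l < k)%N ->
             ~ gradient_reached P (X i) eps (x l) (p l)),
          Mtil P (X i) (x k) /\ f (x k) <= f (x 0%N),
          enorm (agrad (X i) (x k)) <= e,
          [/\ enorm (rgrad (man P) f (p k)) <= grad_bound P (X i) e,
              enorm (grad f (p k)) <= Gbd P
            & enorm (p k - x k) <=
                cMMLS P * Num.sqrt (D%:R : R) * h ^+ m.+1]
        & [/\ (2 * Q * Lt < e -> attained_within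
                 (Num.ceil (16 * (f (x 0%N) - fstar (X i)) / Q * (1 / e)))),
              (e <= 2 * Q * Lt -> attained_within
                 (Num.ceil (32 * (f (x 0%N) - fstar (X i)) * Lt
                            * (1 / e ^+ 2))))
            & forall j, (j < k)%N ->
                exec f (agrad (X i)) (aretr (X i))
                  (iteration Q Lt (Eerr P (X i) (p j)) (x j))
                = ((f (x j), x j.+1), (1, 1, 1)%N)]])
  /\
  (forall p : I -> 'rV[R]_D, (forall i, man P (p i)) ->
    fill (X i) @[i --> F] --> (0 : R) ->
    [/\ grad_bound P (X i) (eps5 P (X i) eps (p i)) @[i --> F] --> eps,
        8 * Lv (X i) @[i --> F] --> (0 : R)
      & floor_term P (X i) (p i) @[i --> F] --> (0 : R)]).
Proof.
split=> [i x p f h m Q Lt x0 xp perf|p Mp h0].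
- have Lt0 : 0 < Lt by case: HP => _ _ _ _ [_ _ _ [_ _ _ _ ?] _].
  have Q0 : 0 < Q by case: (HQ i).
  have [k rk nr] := tolerance_reached HP (HX i) (HL i) (HQ i) (HK i) (HQL i)
    (Hlow i) Heps x0 xp perf.
  have [Mk dec] := iterates_decrease HP (HX i) (HL i) (HQ i) (HK i) (HQL i)
    x0 xp perf nr.
  have [man_k mmls_k] := xp _ Mk.
  exists k => e attained_within.
  have e0 : 0 < e by apply: lt_trans Heps _; exact: eps5_gt HP (HK i).
  have [j jk [Mj fj gj cnt]] := iteration_count HP (HX i) (HL i) (HQ i) (HK i)
    (HQL i) (Hlow i) x0 xp perf nr e0 rk.
  have bound l : Mtil P (X i) (x l) -> enorm (agrad (X i) (x l)) <= e ->
      enorm (rgrad (man P) f (p l)) <= grad_bound P (X i) e.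
    move=> Ml gl; have [man_l mmls_l] := xp _ Ml.
    by apply: (rgrad_man_le_bound HP (HX i) man_l); rewrite mmls_l.
  have attain (v : R) : j%:R <= v -> attained_within (Num.ceil v).
    move=> jv; exists j; last by split=> //; exact: bound.
    by rewrite jk -(ler_int R) (le_trans _ (ceil_ge v)).
  have fk : f (x k) <= f (x 0%N).
    have := dec 0 (lexx _) (fun l _ => enorm_ge0 _).
    by rewrite /min_decrease mulr0 expr0n /= !mul0r minxx mulr0 subr_ge0.
  split; [exact: nr|exact: conj Mk fk|exact: rk| |].
  + split; first exact: bound Mk rk.
      by case: HP => _ _ _ _ [_ _ _ _ /(_ _ man_k)].
    have [_ _ _ _ [_ cst_]] := HX i; have [_ _ close _ _] := cst_ _ man_k.
    by move: close; rewrite enormBC mmls_k.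
  + split.
    * move=> Qe; apply: attain; move: cnt.
      rewrite (min_decreasel Lt0 (ltW e0) (ltW Qe)) -/Q => cnt.
      have -> : 16 * (f (x 0%N) - fstar (X i)) / Q * (1 / e)
          = (f (x 0%N) - fstar (X i)) / (Q * e / 16).
        by field; rewrite !gt_eqF.
      by rewrite ler_pdivlMr// !mulr_gt0.
    * move=> Qe; apply: attain; move: cnt.
      rewrite (min_decreaser Lt0 (ltW e0) Qe) => cnt.
      have -> : 32 * (f (x 0%N) - fstar (X i)) * Lt * (1 / e ^+ 2)
          = (f (x 0%N) - fstar (X i)) / (e ^+ 2 / (32 * Lt)).
        by field; rewrite !gt_eqF.
      by rewrite ler_pdivlMr// divr_gt0 ?exprn_gt0 ?mulr_gt0.
    * move=> l lk; have [_ _ _ _ ->] // := perf l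
        (fun l' l'l => nr l' (leq_ltn_trans l'l lk)).
- have Lv0 i : 0 < Lv (X i) by case: (HK i).
  have Lvc := HLv h0.
  have floor0 := cvg0_floor_term (FF := FF) HP HX Lv0 Mp h0 Lvc.
  split=> //.
  + have hm := cvg0_fill_pow (FF := FF)
      ((cf P + 2 * cM P * Gbd P) * Num.sqrt (D%:R : R)) HP h0.
    have := cvgD hm (cvgD floor0 (cvg_cst eps)).
    by rewrite !add0r; apply.
  + by have := cvgM (cvg_cst (8 : R)) Lvc; rewrite mulr0; apply.
Qed.
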